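(* Let $G$ be a finitely generated non-amenable group, let $B$ be a (finite or infinite) symmetric generating subset of $G$, and let $\mu\in\mathcal{P}_s(B)$ be a symmetric probability measure with support $B$. Assume that there exists a neighborhood $\mathcal{N}_0$ of $\mu$ in $\mathcal{P}_s(B)$ such that the first-moment deviation inequality holds uniformly for driving measures in $\mathcal{N}_0$ and also uniformly with respect to all the Green metrics $d_{\mathcal{G}}^{\mu'}$ associated with measures $\mu'\in\mathcal{N}_0$, i.e. $$\sup_{\mu'\in\mathcal{N}_0}\ \sup_{\mu''\in\mathcal{N}_0}\ \sup_{n,m\in\mathbb{N}}\ \mathbb{E}^{\mu''}\big[(id,Z_{n+m})^{\mu'}_{Z_n}\big]<\infty ,$$ where $(\cdot,\cdot)^{\mu'}_{\cdot}$ is the Gromov product in the metric $d_{\mathcal{G}}^{\mu'}$. Assume that $\mu$ has a finite first moment. Then there exists a neighborhood $\mathcal{N}$ of $\mu$ in $\mathcal{P}_s(B)$ such that the asymptotic entropy $h$ is Lipschitz continuous on $\mathcal{N}$: there is a constant $C$ with $|h(\mu_1)-h(\mu_0)|\le C\,\mathbf{n}(\mu_0,\mu_1)$ for all $\mu_0,\mu_1\in\mathcal{N}$.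
   Context: $\mathcal{P}_s(B)$ is the set of symmetric probability measures on $G$ with support equal to $B$ (symmetric: $\mu(x)=\mu(x^{-1})$). For $\mu_0,\mu_1$ with support $B$, $\mathbf{n}(\mu_0,\mu_1)=\sup_{a\in B}\max\big(\frac{\mu_0(a)}{\mu_1(a)},\frac{\mu_1(a)}{\mu_0(a)}\big)-1\in[0,\infty]$. A neighborhood of $\mu$ in $\mathcal{P}_s(B)$ is a set of the form $\{\mu'\in\mathcal{P}_s(B):\mathbf{n}(\mu',\mu)\le K\}$ with $K>0$. Random walk: under $\mathbb{P}^\mu$ (expectation $\mathbb{E}^\mu$), $X_1,X_2,\dots$ are i.i.d. of law $\mu$, $Z_0=id$, $Z_n=X_1\cdots X_n$. Finite first moment: $\sum_{x}d(id,x)\mu(x)<\infty$ for a word metric $d$ (of a finite generating set). Entropy: $H(\mu)=\sum_{x\in G}(-\log\mu(x))\mu(x)$ and, when finite, $h(\mu)=\lim_n\frac1nH(\mu^n)$, $\mu^n$ being the $n$-th convolution power. Green metric of a symmetric measure $\mu$ whose support generates the non-amenable group $G$: $G^\mu(x)=\sum_{n\ge0}\mu^n(x)<\infty$ and $d_{\mathcal{G}}^\mu(x,y)=\log G^\mu(id)-\log G^\mu(x^{-1}y)$; it is a left-invariant metric on $G$. Gromov product in a metric $d$: $(x,y)_w=\frac12(d(w,x)+d(w,y)-d(x,y))$. *)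

(* Defs.v *)
From HB Require Import structures.
From mathcomp Require Import all_boot all_order all_algebra finmap.
From mathcomp Require Import all_classical all_reals all_analysis.

Set Implicit Arguments.
Unset Strict Implicit.
Unset Printing Implicit Defensive.

Import Order.TTheory GRing.Theory Num.Theory.
Import numFieldNormedType.Exports.

Local Open Scope classical_set_scope.
Local Open Scope ring_scope.

Section Groups.
Variable G : groupType.

Definition is_subgroup (H : set G) : Prop :=
  [/\ H 1%g, (forall x y, H x -> H y -> H (x * y)%g)
    & forall x, H x -> H (x^-1)%g].

Definition generates (S : set G) : Prop := smallest is_subgroup S = setT.

Definition symmetric_set (B : set G) : Prop := forall x, B x -> B (x^-1)%g.

End Groups.

Definition finitely_generated (G : groupType) : Prop :=
  exists2 S : set G, finite_set S & generates S.

Section Amenability.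
Variables (R : realType) (G : groupType).

(* A left-invariant finitely additive probability measure on all subsets. *)
Definition invariant_mean (m : set G -> R) : Prop :=
  [/\ m setT = 1, (forall A, 0 <= m A),
      (forall A B, A `&` B = set0 -> m (A `|` B) = m A + m B)
    & forall g A, m [set (g * x)%g | x in A] = m A].

Definition amenable : Prop := exists m, invariant_mean m.

End Amenability.

Section WordMetric.
Variables (R : realType) (G : groupType).
Implicit Type S : set G.

(* Words in the letters of S and their inverses that represent x. *)
Definition words_for S (x : G) : set (seq G) :=
  [set w | (forall s, s \in w -> S s \/ S (s^-1)%g) /\ (\prod_(s <- w) s)%g = x].

(* The infimum is +oo when no word represents x^-1 * y, which does not happen
   when S generates G. *)
Definition word_metric S (x y : G) : \bar R :=
  ereal_inf [set (size w)%:R%:E | w in words_for S (x^-1 * y)%g].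

End WordMetric.

Section Measures.
Variables (R : realType) (G : groupType).
(* Finitely generated groups are countable, so a probability measure on G is
   represented by its mass function. *)
Implicit Types mu nu : G -> R.

Definition is_pmf mu : Prop :=
  (forall x, 0 <= mu x) /\ \esum_(x in [set: G]) (mu x)%:E = 1%E.

Definition Ps (B : set G) : set (G -> R) :=
  [set mu | [/\ is_pmf mu, (forall x, mu x = mu (x^-1)%g)
              & [set x | mu x != 0] = B]].

Definition ndist (B : set G) mu0 mu1 : \bar R :=
  (ereal_sup [set (Num.max (mu0 a / mu1 a) (mu1 a / mu0 a))%:E | a in B] - 1)%E.

Definition neighborhood (B : set G) mu : set (set (G -> R)) :=
  [set N | exists2 K : R, 0 < K
         & N = [set mu' | Ps B mu' /\ (ndist B mu' mu <= K%:E)%E]].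

Definition finite_first_moment mu : Prop :=
  exists S : set G, [/\ finite_set S, generates S
    & (\esum_(x in [set: G]) (word_metric R S 1%g x * (mu x)%:E) < +oo)%E].

Definition convolution mu nu (x : G) : R :=
  fine (\esum_(y in [set: G]) (mu y * nu (y^-1 * x)%g)%:E).

Definition convolution_power mu (n : nat) : G -> R :=
  iter n (fun nu => convolution nu mu) (fun x => (x == 1%g)%:R).

(* At points of zero mass the term is 0, as it should be. *)
Definition entropy mu : \bar R :=
  \esum_(x in [set: G]) (- ln (mu x) * mu x)%:E.

Definition entropy_rate mu : R^nat :=
  fun n => n%:R^-1 * fine (entropy (convolution_power mu n)).

Definition asymptotic_entropy mu : R := limn (entropy_rate mu).

(* Guarantees that asymptotic_entropy mu is a genuine limit of finite values:
   the entropy of mu^n is at most n times that of mu. *)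
Definition asymptotic_entropy_defined mu : Prop :=
  (entropy mu < +oo)%E /\ cvgn (entropy_rate mu).

Definition green_function mu (x : G) : \bar R :=
  (\sum_(0 <= n <oo) (convolution_power mu n x)%:E)%E.

Definition green_metric mu (x y : G) : R :=
  ln (fine (green_function mu 1%g)) - ln (fine (green_function mu (x^-1 * y)%g)).

Definition gromov_product (d : G -> G -> R) (x y w : G) : R :=
  (d w x + d w y - d x y) / 2%:R.

End Measures.

Section RandomWalk.
Variables (R : realType) (G : groupType).
Variables (disp : measure_display) (Omega : measurableType disp).

(* G carries the discrete sigma-algebra. *)
Definition iid_of_law (P : probability Omega R) (X : nat -> Omega -> G)
    (mu : G -> R) : Prop :=
  [/\ (forall i (A : set G), measurable (X i @^-1` A)),
      (forall i x, P (X i @^-1` [set x]) = (mu x)%:E)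
    & forall (J : {fset nat}) (A : nat -> set G),
        P (\bigcap_(i in [set` J]) X i @^-1` A i)
        = (\prod_(i <- J) P (X i @^-1` A i))%E].

(* The increments are indexed from 0: X 0 is the first one. *)
Definition walk (X : nat -> Omega -> G) (n : nat) (w : Omega) : G :=
  (\prod_(i < n) X i w)%g.

End RandomWalk.

(* Main.v *)
(** Non-amenability makes the walk driven by any symmetric nu with support B
    transient with exponentially decaying return probabilities (Kesten), so the
    Green distance D^nu(x) = ln G^nu(1) - ln G^nu(x) is finite.  Two
    comparisons replace the identity between entropy and the Green speed:
    nu^n(x) <= G^nu(x) / G^nu(1) gives E[D^nu(Z_n)] <= H(nu^n), and Gibbs'
    inequality against a normalized resolvent of nu gives
    H(p) <= (1 + eta) E_p[D^nu] + C_eta for every probability p.  With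
    D = D^{mu0} these yield
      H(mu1^n) <= (1 + eta) E^{mu1}[D(Z_n)] + C_eta  and
      E^{mu0}[D(Z_n)] <= H(mu0^n),
    so it is enough to bound E^{mu1}[D(Z_n)] - E^{mu0}[D(Z_n)] by
    C n ndist(mu0, mu1).  For this, mu0 is moved to mu1 along a segment in n
    steps, replacing one increment at a time.  By the deviation inequality
    D(a x b) differs from D(a) + D(b) by a quantity whose expectation is bounded
    by a constant plus the expectation of - ln mu0(x), and the sum D(a) + D(b)
    does not depend on the increment x that is being replaced. *)
Require Import Defs.
From HB Require Import structures.
From mathcomp Require Import all_boot all_order all_algebra finmap.
From mathcomp Require Import all_classical all_reals all_analysis.
From mathcomp Require Import measurable_realfun lra.

Set Implicit Arguments.
Unset Strict Implicit.
Unset Printing Implicit Defensive.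

Import Order.TTheory GRing.Theory Num.Theory.
Import numFieldNormedType.Exports.

Local Open Scope classical_set_scope.
Local Open Scope ring_scope.

(** * Sums of nonnegative families *)

(** Two obstacles shape the argument. With [d = ndist B mu0 mu1], the [n]-step laws of [mu0] and
    [mu1] are comparable only up to the factor [(1 + d)^n], which is useless at the scale of [n]. On
    a segment cut into [n] pieces, neighbouring measures have ratio at most [1 + d / n], and the
    [n]-th power of this stays below [exp d]. A piece requires [n] replacements of cost [O(d / n)]
    each, hence [O(d)], and the [n] pieces together cost [O(n d)]. The Green distance is frozen
    while the driving measure moves along the segment, so the deviation bound is needed for a walk
    and a metric that come from different measures. The second obstacle is that the Green function
    has infinite total mass on [G], so Gibbs' inequality cannot be applied to it. A resolvent at a
    parameter [u < 1] has finite mass and is bounded below by a multiple of the power [1 + eta] of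
    the Green function, thanks to the exponential decay. The constant disappears on division by [n],
    and [eta] tends to 0 only after the limit in [n]. *)

Section RealSums.
Variable R : realType.
Implicit Types T : choiceType.

(** Unordered sums with values in the extended reals: for nonnegative families Tonelli then holds
    without summability or countability, so laws on [G] can be handled before [G] is known to be
    countable. *)
Definition rsum T (f : T -> R) : \bar R := \esum_(x in [set: T]) (f x)%:E.

Lemma rsum_ge0 T (f : T -> R) : (forall x, 0 <= f x) -> (0 <= rsum f)%E.
Proof. by move=> f0; apply: esum_ge0 => x _; rewrite lee_fin. Qed.

Lemma rsum_le T (f g : T -> R) :
  (forall x, f x <= g x) -> (rsum f <= rsum g)%E.
Proof. by move=> fg; apply: le_esum => x _; rewrite lee_fin. Qed.

Lemma eq_rsum T (f g : T -> R) : f =1 g -> rsum f = rsum g.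
Proof. by move=> fg; apply: eq_esum => x _; rewrite fg. Qed.

Lemma rsumD T (f g : T -> R) : (forall x, 0 <= f x) -> (forall x, 0 <= g x) ->
  rsum (fun x => f x + g x) = (rsum f + rsum g)%E.
Proof.
by move=> f0 g0; rewrite /rsum -esumD// => x _; rewrite lee_fin.
Qed.

(** Finite subsums give one inequality for every scalar; the same inequality for [c^-1] gives the
    other one. *)
Lemma esumZl T (c : R) (f : T -> \bar R) : 0 <= c -> (forall x, 0 <= f x)%E ->
  \esum_(x in [set: T]) (c%:E * f x)%E = (c%:E * \esum_(x in [set: T]) f x)%E.
Proof.
move=> c0 f0.
have half (d : R) (g : T -> \bar R) : 0 <= d -> (forall x, 0 <= g x)%E ->
    (\esum_(x in [set: T]) (d%:E * g x) <= d%:E * \esum_(x in [set: T]) g x)%E.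
  move=> d0 g0; apply: ge_ereal_sup => /= _ [X [finX _]] <-.
  rewrite -ge0_mule_fsumr//; apply: lee_wpmul2l; first by rewrite lee_fin.
  by apply: ereal_sup_ubound; exists X.
apply/eqP; rewrite eq_le half//=.
have [->|c_neq0] := eqVneq c 0.
  by rewrite mul0e esum_ge0// => x _; rewrite mul0e.
have c_gt0 : 0 < c by rewrite lt0r c_neq0.
have := half c^-1 (fun x => c%:E * f x)%E.
rewrite invr_ge0 c0 => /(_ isT) h.
rewrite -(mul1e (\esum_(x in _) (_ * _))%E) -(divff c_neq0) EFinM -muleA.
apply: lee_wpmul2l; first by rewrite lee_fin.
apply: le_trans (h _); last by move=> x; rewrite mule_ge0// lee_fin.
by apply: le_esum => x _; rewrite muleA -EFinM mulVf// mul1e.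
Qed.

Lemma rsumZ T (c : R) (f : T -> R) : 0 <= c -> (forall x, 0 <= f x) ->
  rsum (fun x => c * f x) = (c%:E * rsum f)%E.
Proof.
by move=> c0 f0; rewrite /rsum -esumZl.
Qed.

Lemma rsumZr T (c : R) (f : T -> R) : 0 <= c -> (forall x, 0 <= f x) ->
  rsum (fun x => f x * c) = (rsum f * c%:E)%E.
Proof.
by move=> c0 f0; rewrite muleC -rsumZ//; apply: eq_rsum => x; rewrite mulrC.
Qed.

Lemma rsum_reindex T T' (e : T -> T') (f : T' -> R) : bijective e ->
  rsum f = rsum (f \o e).
Proof.
move=> [e' ee' e'e]; rewrite /rsum; apply: reindex_esum; split => //=.
- by move=> x y _ _ /(congr1 e'); rewrite !ee'.
- by move=> y _; exists (e' y).
Qed.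

Lemma rsum_pair T1 T2 (f : T1 * T2 -> R) : (forall t, 0 <= f t) ->
  rsum f = \esum_(x in [set: T1]) rsum (fun y => f (x, y)).
Proof.
move=> f0; rewrite /rsum.
rewrite (esum_esum (J := fun=> [set: T2]) (a := fun x y => (f (x, y))%:E))//.
  by congr esum; [apply/seteqP; split|apply/funext => -[x y]].
by move=> i j _ _; rewrite lee_fin.
Qed.

Lemma rsum_swap T1 T2 (f : T1 -> T2 -> R) : (forall x y, 0 <= f x y) ->
  \esum_(x in [set: T1]) rsum (f x) = \esum_(y in [set: T2]) rsum (f ^~ y).
Proof.
move=> f0.
rewrite -(rsum_pair (f := fun t => f t.1 t.2))//.
rewrite -(rsum_pair (f := fun t => f t.2 t.1))//.
rewrite (rsum_reindex (e := fun t : T1 * T2 => (t.2, t.1)))//.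
by exists (fun t => (t.2, t.1)) => -[].
Qed.

Lemma rsum_prod T1 T2 (f : T1 -> R) (g : T2 -> R) :
  (forall x, 0 <= f x) -> (forall x, 0 <= g x) ->
  rsum (fun t : T1 * T2 => f t.1 * g t.2) = (rsum f * rsum g)%E.
Proof.
move=> f0 g0; rewrite rsum_pair/=; last by move=> t; apply: mulr_ge0.
under eq_esum => x _ do rewrite rsumZ//.
have [gfin|] := boolP (rsum g < +oo)%E.
  have gE : (fine (rsum g))%:E = rsum g by rewrite fineK// ge0_fin_numE// rsum_ge0.
  rewrite -gE; under eq_esum => x _ do rewrite muleC.
  have g_ge0 : 0 <= fine (rsum g) by rewrite fine_ge0// rsum_ge0.
  by rewrite (esumZl (f := EFin \o f) g_ge0) 1?muleC// => x; rewrite lee_fin.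
(* With an infinite second factor, the product is 0 if [f] vanishes identically, by the convention
   on [0 * +oo], and [+oo] otherwise. *)
rewrite -leNgt leye_eq => /eqP ->.
have [f_eq0|] := pselect (forall x, f x = 0).
  rewrite esum1; last by move=> x _; rewrite f_eq0 mul0e.
  by rewrite /rsum esum1 ?mul0e// => x _; rewrite f_eq0.
move=> /existsNP[x0 /eqP fx0].
have fx0_gt0 : 0 < f x0 by rewrite lt0r fx0 f0.
have le1 (h : T1 -> \bar R) : (forall x, 0 <= h x)%E ->
    (h x0 <= \esum_(x in [set: T1]) h x)%E.
  move=> h0; apply: esum_ge; exists [set x0]; last by rewrite fsbig_set1.
  by split.
transitivity (+oo : \bar R)%E; last first.
  rewrite gt0_muley//; apply: (lt_le_trans (y := (f x0)%:E)); rewrite ?lte_fin//.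
  by apply: (le1 (EFin \o f)) => x; rewrite lee_fin.
apply/eqP; rewrite -leye_eq; apply: le_trans (le1 _ _); last first.
  by move=> x; rewrite mule_ge0// lee_fin.
by rewrite gt0_muley// lte_fin.
Qed.

Lemma rsum_ge1 T (f : T -> R) (x : T) : (forall y, 0 <= f y) ->
  ((f x)%:E <= rsum f)%E.
Proof.
move=> f0; apply: esum_ge; exists [set x]; last by rewrite fsbig_set1.
by split.
Qed.

Lemma rsum_fset_le T (f : T -> R) (M : \bar R) :
  (forall F : {fset T}, ((\sum_(x <- F) f x)%:E <= M)%E) -> (rsum f <= M)%E.
Proof.
move=> h; apply: ge_ereal_sup => /= _ [X [finX _]] <-.
by rewrite fsbig_finite//= sumEFin.
Qed.

Lemma rsum_ge_fset T (f : T -> R) (F : {fset T}) :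
  ((\sum_(x <- F) f x)%:E <= rsum f)%E.
Proof.
apply: esum_ge; exists [set` F]; first by split.
by rewrite fsbig_finite//= set_fsetK sumEFin.
Qed.

Lemma rsum_fineK T (f : T -> R) : (forall x, 0 <= f x) -> (rsum f < +oo)%E ->
  (fine (rsum f))%:E = rsum f.
Proof. by move=> f0 ff; rewrite fineK// ge0_fin_numE// rsum_ge0. Qed.

Lemma rsum_delta T (f : T -> R) (a : T) : (forall x, 0 <= f x) ->
  rsum (fun x => (x == a)%:R * f x) = (f a)%:E.
Proof.
move=> f0; rewrite /rsum -[RHS](@esum_set1 _ _ _ (EFin \o f)) ?lee_fin//.
rewrite [RHS]esum_mkcond; apply: eq_esum => x _.
have [->|/eqP xa] := eqVneq x a; first by rewrite mem_set// mul1r.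
by rewrite memNset// mul0r.
Qed.

End RealSums.

(** * Convolution powers *)

Section Convolution.
Variables (R : realType) (G : groupType).
Implicit Types (p q r : G -> R) (F : G -> R) (x y : G).

Definition expect p F : \bar R := rsum (fun x => p x * F x).

Lemma pmf_ge0 p x : is_pmf p -> 0 <= p x.
Proof. by case. Qed.

Lemma pmf_sum p : is_pmf p -> rsum p = 1%E.
Proof. by case. Qed.

Lemma pmf_le1 p x : is_pmf p -> p x <= 1.
Proof.
by move=> [p0 p1]; rewrite -lee_fin -p1; apply: (rsum_ge1 (f := p)).
Qed.

Lemma expect_cst p (c : R) : is_pmf p -> 0 <= c ->
  expect p (fun=> c) = c%:E.
Proof.
move=> [p0 p1] c0; rewrite /expect rsumZr//.
by rewrite -[rsum _]/(rsum p) /rsum p1 mul1e.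
Qed.

(** [convolution] takes [fine] of a sum, so each use needs finiteness. Domination by a probability
    covers the defective laws of a walk killed at a point. *)
Lemma convE_le p p' q x : (forall y, 0 <= p y <= p' y) -> is_pmf p' ->
  is_pmf q -> (convolution p q x)%:E = rsum (fun y => p y * q (y^-1 * x)%g).
Proof.
move=> pp' pmf_p' pmf_q; have p0 y : 0 <= p y by case/andP: (pp' y).
have pq0 y : 0 <= p y * q (y^-1 * x)%g by rewrite mulr_ge0// pmf_ge0.
apply: rsum_fineK => //; apply: (le_lt_trans (y := 1%E)); last exact: ltry.
rewrite -(pmf_sum pmf_p'); apply: rsum_le => y.
by rewrite (le_trans (y := p y)) ?ler_piMr ?pmf_le1//; case/andP: (pp' y).
Qed.

Lemma convE p q x : is_pmf p -> is_pmf q ->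
  (convolution p q x)%:E = rsum (fun y => p y * q (y^-1 * x)%g).
Proof.
by move=> pp; apply: convE_le (pp) => y; rewrite lexx pmf_ge0.
Qed.

Lemma conv_ge0 p q x : is_pmf p -> is_pmf q -> 0 <= convolution p q x.
Proof.
move=> pp pq; rewrite -lee_fin convE//; apply: rsum_ge0 => y.
by rewrite mulr_ge0 ?pmf_ge0.
Qed.

Lemma bij_mulgl x : bijective (fun y : G => x * y)%g.
Proof. by exists (fun y => x^-1 * y)%g => y; rewrite ?mulKg ?mulVKg. Qed.

Lemma expect_conv p q F : is_pmf p -> is_pmf q -> (forall x, 0 <= F x) ->
  expect (convolution p q) F =
  rsum (fun t : G * G => p t.1 * q t.2 * F (t.1 * t.2)%g).
Proof.
move=> pp pq F0.
have pqF y x : 0 <= p y * q (y^-1 * x)%g * F x.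
  by rewrite !mulr_ge0// ?pmf_ge0.
transitivity (\esum_(x in [set: G]) rsum (fun y => p y * q (y^-1 * x)%g * F x)).
  apply: eq_esum => x _; rewrite EFinM convE// muleC -rsumZ//; last first.
    by move=> y; rewrite mulr_ge0 ?pmf_ge0.
  by apply: eq_rsum => y; rewrite mulrC.
rewrite rsum_swap// rsum_pair/=; last first.
  by move=> t; rewrite !mulr_ge0// ?pmf_ge0.
apply: eq_esum => y _; rewrite (rsum_reindex _ (bij_mulgl y)).
by apply: eq_rsum => z /=; rewrite mulKg.
Qed.

Lemma conv_pmf p q : is_pmf p -> is_pmf q -> is_pmf (convolution p q).
Proof.
move=> pp pq; split=> [x|]; first exact: conv_ge0.
transitivity (expect (convolution p q) (fun=> 1)).
  by apply: eq_rsum => x; rewrite mulr1.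
rewrite expect_conv//.
transitivity (rsum (fun t : G * G => p t.1 * q t.2)).
  by apply: eq_rsum => t; rewrite mulr1.
rewrite rsum_prod ?pmf_sum ?mule1// => x; exact: pmf_ge0.
Qed.

Lemma convA p q r : is_pmf p -> is_pmf q -> is_pmf r ->
  convolution (convolution p q) r = convolution p (convolution q r).
Proof.
move=> pp pq pr; apply/funext => x; apply: EFin_inj.
rewrite convE//; last exact: conv_pmf.
rewrite -[LHS]/(expect (convolution p q) (fun y => r (y^-1 * x)%g)).
rewrite expect_conv//; last by move=> y; apply: pmf_ge0.
rewrite convE//; last exact: conv_pmf.
rewrite rsum_pair/=; last by move=> t; rewrite !mulr_ge0// ?pmf_ge0.
apply: eq_esum => a _; rewrite EFinM convE// -rsumZ ?pmf_ge0//; last first.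
  by move=> y; rewrite !mulr_ge0// ?pmf_ge0.
by apply: eq_rsum => b; rewrite mulrA invgM mulgA.
Qed.

Definition dirac1 (x : G) : R := (x == 1%g)%:R.

Lemma dirac1_pmf : is_pmf dirac1.
Proof.
split=> [x|]; first by rewrite ler0n.
transitivity (rsum (fun x : G => (x == 1%g)%:R * (1 : R))).
  by apply: eq_rsum => x; rewrite mulr1.
by rewrite (rsum_delta (f := fun=> 1)).
Qed.

Lemma conv1p p : is_pmf p -> convolution dirac1 p = p.
Proof.
move=> pp; apply/funext => x; apply: EFin_inj.
rewrite convE//; last exact: dirac1_pmf.
rewrite (rsum_delta (f := fun y => p (y^-1 * x)%g)) ?invg1 ?mul1g// => y.
exact: pmf_ge0.
Qed.

Lemma convp1 p : is_pmf p -> convolution p dirac1 = p.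
Proof.
move=> pp; apply/funext => x; apply: EFin_inj.
rewrite convE//; last exact: dirac1_pmf.
rewrite -(rsum_delta (f := p) x); last by move=> y; apply: pmf_ge0.
apply: eq_rsum => y; rewrite mulrC /dirac1; congr ((nat_of_bool _)%:R * _).
by apply/eqP/eqP => [/(congr1 (fun z => y * z)%g)|->]; rewrite ?mulVKg ?mulg1// mulVg.
Qed.

Variable p : G -> R.
Hypothesis pp : is_pmf p.
Local Notation c := (convolution_power p).

Lemma cpow0 : c 0 = dirac1. Proof. by []. Qed.

Lemma cpowS n : c n.+1 = convolution (c n) p. Proof. by []. Qed.

Lemma cpow_pmf n : is_pmf (c n).
Proof.
elim: n => [|n IH]; first exact: dirac1_pmf.
by rewrite cpowS; apply: conv_pmf.
Qed.

Lemma cpow_ge0 n x : 0 <= c n x.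
Proof. exact/pmf_ge0/cpow_pmf. Qed.

Lemma cpowD n m : c (n + m) = convolution (c n) (c m).
Proof.
elim: m => [|m IH]; first by rewrite addn0 cpow0 convp1//; apply: cpow_pmf.
by rewrite addnS !cpowS IH convA//; apply: cpow_pmf.
Qed.

Lemma cpow1 : c 1 = p.
Proof. by rewrite cpowS cpow0 conv1p. Qed.

Lemma cpowSl n : c n.+1 = convolution p (c n).
Proof. by rewrite -{2}cpow1 -cpowD. Qed.

Lemma conv_ge q q' x y : is_pmf q -> is_pmf q' ->
  q x * q' y <= convolution q q' (x * y)%g.
Proof.
move=> pq pq'; rewrite -lee_fin convE//.
rewrite -{1}[y](mulKg x).
apply: (rsum_ge1 (f := fun z => q z * q' (z^-1 * (x * y))%g)) => z.
by rewrite mulr_ge0 ?pmf_ge0.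
Qed.

Lemma cpow_mul_ge n m x y : c n x * c m y <= c (n + m) (x * y)%g.
Proof. by rewrite cpowD; apply: conv_ge; apply: cpow_pmf. Qed.

Lemma conv_invg q q' x : is_pmf q -> is_pmf q' ->
  (forall y, q y^-1%g = q y) -> (forall y, q' y^-1%g = q' y) ->
  convolution q q' x^-1%g = convolution q' q x.
Proof.
move=> pq pq' qV q'V; apply: EFin_inj; rewrite !convE//.
rewrite [RHS](rsum_reindex _ (bij_mulgl x)); apply: eq_rsum => y /=.
by rewrite -invgM q'V invgM mulgVK qV mulrC.
Qed.

Lemma le_conv q q' r r' (a b : R) : is_pmf q -> is_pmf q' -> is_pmf r ->
  is_pmf r' -> 0 <= a -> 0 <= b ->
  (forall x, q x <= a * q' x) -> (forall x, r x <= b * r' x) ->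
  forall x, convolution q r x <= (a * b) * convolution q' r' x.
Proof.
move=> pq pq' pr pr' a0 b0 qq' rr' x.
rewrite -lee_fin EFinM !convE// -rsumZ ?mulr_ge0//; last first.
  by move=> y; rewrite mulr_ge0 ?pmf_ge0.
apply: rsum_le => y; rewrite mulrACA; apply: ler_pM; rewrite ?pmf_ge0//.
Qed.

End Convolution.

Lemma le_cpow (R : realType) (G : groupType) (p q : G -> R) (a : R) n :
  is_pmf p -> is_pmf q -> 0 <= a -> (forall x, p x <= a * q x) ->
  forall x, convolution_power p n x <= a ^+ n * convolution_power q n x.
Proof.
move=> pp pq a0 pq_le; elim: n => [|n IH] x; first by rewrite expr0 mul1r.
rewrite !cpowS exprSr; apply: le_conv; rewrite ?exprn_ge0//; exact: cpow_pmf.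
Qed.

(** * Kesten's criterion *)

Section MeanFromSequence.
Variables (R : realType) (T : Type).

(** A limit along an ultrafilter finer than the Fréchet filter exists for every set at once, because
    the values lie in the compact interval from 0 to 1. The last clause turns asymptotic invariance
    into exact invariance. *)
Lemma ultralimit_mean (m_ : nat -> set T -> R) :
  (forall j, m_ j setT = 1) -> (forall j A, 0 <= m_ j A <= 1) ->
  (forall j A B, A `&` B = set0 -> m_ j (A `|` B) = m_ j A + m_ j B) ->
  exists m : set T -> R, [/\ m setT = 1, (forall A, 0 <= m A),
    (forall A B, A `&` B = set0 -> m (A `|` B) = m A + m B) &
    forall A B, (forall e : R, 0 < e -> \forall j \near \oo, m_ j A <= m_ j B + e) ->
      m A <= m B].
Proof.
move=> m1 m01 mU.
have [U [UU ooU]] := ultraFilterLemma eventually_filter.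
have UP : ProperFilter U by apply: ultra_proper.
have cvgU (A : set T) : exists l : R, m_ ^~ A @ U --> l.
  have UA : (m_ ^~ A @ U) [set` `[0, 1]%R].
    by apply: (filterE (F := U)) => j; rewrite /= in_itv/= m01.
  have [l [_ cl]] := @segment_compact R 0 1 (m_ ^~ A @ U) _ UA.
  exists l => V lV.
  have [//|UnV] := in_ultra_setVsetC (m_ ^~ A @^-1` V) UU.
  by have [x []] := cl (~` V) V UnV lV.
have [m mP] := choice cvgU.
have hs : hausdorff_space R by exact: Rhausdorff.
exists m; split.
- apply: (cvg_unique hs (mP setT)).
  by rewrite (_ : m_ ^~ setT = cst 1); [exact: cvg_cst|exact/funext].
- move=> A; apply: (closed_cvg (fun x : R => 0 <= x) _ _ _ (mP A)).
    exact: closed_ge.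
  by apply: filterE => j; have /andP[] := m01 j A.
- move=> A B AB; apply: (cvg_unique hs (mP _)).
  rewrite (_ : m_ ^~ (A `|` B) = (fun j => m_ j A + m_ j B)).
    exact: cvgD.
  by apply/funext => j; apply: mU.
- move=> A B le_AB; apply/ler_addgt0Pr => e e0.
  suff : - e <= m B - m A by lra.
  have cBA : (fun j => m_ j B - m_ j A) @ U --> m B - m A.
    by apply: cvgB.
  apply: (closed_cvg (fun x => - e <= x) _ _ _ cBA); first exact: closed_ge.
  apply: ooU.
  by apply: filterS (le_AB _ e0) => j /=; lra.
Qed.

End MeanFromSequence.

Section SymmetricPowers.
Variables (R : realType) (G : groupType) (B : set G) (nu : G -> R).
Hypothesis nuB : Ps B nu.
Local Notation c := (convolution_power nu).

Let nu_pmf : is_pmf nu. Proof. by case: nuB. Qed.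
Let c_pmf n : is_pmf (c n). Proof. exact: cpow_pmf. Qed.
Let c0 n x : 0 <= c n x. Proof. exact: cpow_ge0. Qed.

Lemma Ps_pmf : is_pmf nu. Proof. exact: nu_pmf. Qed.

Lemma Ps_sym x : nu x^-1%g = nu x.
Proof. by case: nuB => _ + _ => <-. Qed.

Lemma Ps_gt0 x : B x -> 0 < nu x.
Proof.
case: nuB => _ _ <- /= nux.
by rewrite lt0r nux pmf_ge0.
Qed.

Lemma Ps_eq0 x : ~ B x -> nu x = 0.
Proof. by case: nuB => _ _ <- /= /negP; rewrite negbK => /eqP. Qed.

Lemma Ps_nonempty : B !=set0.
Proof.
apply/set0P/negP => /eqP B0; have := pmf_sum nu_pmf.
rewrite /rsum esum1 => [/eqP|x _]; last by rewrite Ps_eq0// B0.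
by rewrite eqe eq_sym oner_eq0.
Qed.

Lemma cpow_sym n x : c n x^-1%g = c n x.
Proof.
elim: n x => [|n IH] x; first by rewrite /= invg_eq1.
by rewrite cpowS conv_invg -?cpowSl//; exact: Ps_sym.
Qed.

(** Symmetry makes an even power an l2 correlation of [c n] with its translate, which is what brings
    Hilbert-space estimates into play. *)
Lemma cpow_double n g :
  (c (n + n) g)%:E = rsum (fun x => c n (g * x)%g * c n x).
Proof.
rewrite cpowD// convE// (rsum_reindex _ (bij_mulgl g)).
apply: eq_rsum => x /=.
by rewrite invgM mulgVK cpow_sym.
Qed.

Lemma cpow_double1 n : (c (n + n) 1%g)%:E = rsum (fun x => c n x ^+ 2).
Proof.
by rewrite cpow_double; apply: eq_rsum => x; rewrite mul1g -expr2.
Qed.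

Lemma cpow_double_translate n g :
  rsum (fun x => c n (g * x)%g ^+ 2) = (c (n + n) 1%g)%:E.
Proof.
by rewrite cpow_double1 [RHS](rsum_reindex _ (bij_mulgl g)).
Qed.

(** Cauchy-Schwarz for two translates of equal l2 norm, in the form [u v <= (u^2 + v^2) / 2]. *)
Lemma cpow_double_le n g : c (n + n) g <= c (n + n) 1%g.
Proof.
rewrite -lee_fin cpow_double.
apply: (le_trans (y := rsum (fun x => 2^-1 * (c n (g * x)%g ^+ 2 + c n x ^+ 2)))).
  apply: rsum_le => x; have := sqr_ge0 (c n (g * x)%g - c n x); lra.
rewrite rsumZ ?rsumD//; do ?[by move=> x; rewrite ?addr_ge0 ?sqr_ge0].
by rewrite cpow_double_translate -cpow_double1 -EFinD -EFinM lee_fin; lra.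
Qed.

Lemma cpow_double_gt0 n : 0 < c (n + n) 1%g.
Proof.
rewrite lt0r c0 andbT; apply/negP => /eqP cn0.
have := pmf_sum (c_pmf n); rewrite /rsum esum1 => [/eqP|x _].
  by rewrite eqe eq_sym oner_eq0.
congr EFin; apply/eqP; rewrite -sqrf_eq0 eq_le sqr_ge0 andbT -lee_fin.
rewrite -[X in (_ <= X%:E)%E]cn0 cpow_double1.
by apply: (rsum_ge1 (f := fun x => c n x ^+ 2)) => y; exact: sqr_ge0.
Qed.

(* The left-hand side is one term of the sum
   [sum_g c 2 g (c (2n) 1 - c (2n) g) = c (2n) 1 - c (2n+2) 1]. *)
Lemma cpow_double_gap n g :
  c 2 g * (c (n + n) 1%g - c (n + n) g) <= c (n + n) 1%g - c (n.+1 + n.+1) 1%g.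
Proof.
have gap0 x : 0 <= c (n + n) 1%g - c (n + n) x.
  by rewrite subr_ge0 cpow_double_le.
have : ((c 2 g * (c (n + n) 1%g - c (n + n) g))%:E + (c (n.+1 + n.+1) 1%g)%:E
    <= (c (n + n) 1%g)%:E)%E.
  have -> : (n.+1 + n.+1 = 2 + (n + n))%N by rewrite addSn addnS.
  rewrite [c (2 + _)%N]cpowD// convE//.
  rewrite -[leRHS](expect_cst (c_pmf 2))// /expect.
  pose gap x := c 2 x * (c (n + n) 1%g - c (n + n) x).
  have : ((gap g)%:E <= rsum gap)%E.
    by apply: rsum_ge1 => y; rewrite mulr_ge0.
  pose corr x := c 2 x * c (n + n) (x^-1 * 1)%g.
  move=> /(leeD2r (rsum corr)) /le_trans; apply.
  rewrite -rsumD; do ?[by move=> x; rewrite mulr_ge0].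
  by apply: rsum_le => x; rewrite /corr/gap mulg1 cpow_sym; lra.
by rewrite -EFinD lee_fin; lra.
Qed.

End SymmetricPowers.

Lemma generates_ind (G : groupType) (B P : set G) :
  generates B -> is_subgroup P -> B `<=` P -> forall x, P x.
Proof.
move=> Bgen Psub BP x; have : [set: G] x by [].
by rewrite -Bgen; apply.
Qed.

Section SetMass.
Variables (R : realType) (G : groupType).
Implicit Types (phi : G -> R) (A : set G).

Definition set_mass phi A : R := fine (rsum (fun x => \1_A x * phi x)).

Lemma set_massE phi A : is_pmf phi ->
  (set_mass phi A)%:E = rsum (fun x => \1_A x * phi x).
Proof.
move=> pphi; apply: rsum_fineK => [x|]; first by rewrite mulr_ge0// pmf_ge0.
apply: (le_lt_trans (y := rsum phi)); last by rewrite pmf_sum// ltry.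
by apply: rsum_le => x; rewrite ler_piMl ?pmf_ge0// indicE lern1 leq_b1.
Qed.

Lemma set_massT phi : is_pmf phi -> set_mass phi setT = 1.
Proof.
move=> pphi; apply: EFin_inj; rewrite set_massE// -(pmf_sum pphi).
by apply: eq_rsum => x; rewrite indicE in_setT mul1r.
Qed.

Lemma set_mass_ge0 phi A : is_pmf phi -> 0 <= set_mass phi A.
Proof.
move=> pphi; rewrite fine_ge0// rsum_ge0// => x.
by rewrite mulr_ge0// pmf_ge0.
Qed.

Lemma set_mass_le1 phi A : is_pmf phi -> set_mass phi A <= 1.
Proof.
move=> pphi; rewrite -lee_fin set_massE// -(pmf_sum pphi).
by apply: rsum_le => x; rewrite ler_piMl ?pmf_ge0// indicE lern1 leq_b1.
Qed.

Lemma set_massU phi A A' : is_pmf phi -> A `&` A' = set0 ->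
  set_mass phi (A `|` A') = set_mass phi A + set_mass phi A'.
Proof.
move=> pphi AA'; apply: EFin_inj; rewrite EFinD !set_massE// -rsumD; last 2 first.
- by move=> x; rewrite mulr_ge0// pmf_ge0.
- by move=> x; rewrite mulr_ge0// pmf_ge0.
apply: eq_rsum => x; rewrite -mulrDl; congr (_ * _).
rewrite !indicE in_setU.
have [xA|//] := boolP (x \in A); rewrite /= ?add0r//.
have [xA'|//] := boolP (x \in A'); last by rewrite addr0.
by have : (A `&` A') x by [split; apply: set_mem]; rewrite AA'.
Qed.

Lemma set_mass_translate phi A g : is_pmf phi ->
  (set_mass phi [set (g * x)%g | x in A])%:E =
  rsum (fun x => \1_A x * phi (g * x)%g).
Proof.
move=> pphi; rewrite set_massE// (rsum_reindex _ (bij_mulgl g)).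
apply: eq_rsum => x /=; congr (_ * _); rewrite !indicE.
congr (nat_of_bool _)%:R; apply/idP/idP; last first.
  by move=> xA; rewrite inE/=; exists x => //; apply: set_mem.
rewrite inE => -[y Ay /(congr1 (fun z => g^-1 * z)%g)].
by rewrite !mulKg => <-; apply: mem_set.
Qed.

End SetMass.

Section Kesten.
Variables (R : realType) (G : groupType) (B : set G) (nu : G -> R).
Hypothesis nuB : Ps B nu.
Local Notation c := (convolution_power nu).
Local Notation a n := (c (n + n) 1%g).

Let nu_pmf : is_pmf nu. Proof. by case: nuB. Qed.
Let c0 n x : 0 <= c n x. Proof. exact: cpow_ge0. Qed.

(** The square of the unit vector of l2 proportional to [c n]: almost invariant vectors of l2 become
    almost invariant probability densities. *)
Definition squared_density n x := (a n)^-1 * c n x ^+ 2.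

Lemma squared_density_pmf n : is_pmf (squared_density n).
Proof.
have an : 0 < a n by exact: cpow_double_gt0 nuB n.
split=> [x|]; first by rewrite mulr_ge0 ?sqr_ge0// invr_ge0 ltW.
rewrite -[LHS]/(rsum (squared_density n)) rsumZ; last 2 first.
- by rewrite invr_ge0 ltW.
- by move=> x; exact: sqr_ge0.
by rewrite -(cpow_double1 nuB) -EFinM mulVf ?gt_eqF.
Qed.

Lemma cpow_translate_dist n (g : G) :
  rsum (fun x => (c n (g * x)%g - c n x) ^+ 2) = (2 * (a n - c (n + n) g))%:E.
Proof.
have uv0 x : 0 <= 2 * (c n (g * x)%g * c n x) by rewrite !mulr_ge0.
have : (rsum (fun x => (c n (g * x)%g - c n x) ^+ 2)%R + (2 * c (n + n) g)%R%:E
   = (2 * a n)%R%:E)%E.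
  rewrite EFinM (cpow_double nuB) -rsumZ//; last by move=> x; rewrite mulr_ge0.
  rewrite -rsumD//; last by move=> x; exact: sqr_ge0.
  transitivity (rsum (fun x => c n (g * x)%g ^+ 2 + c n x ^+ 2)).
    by apply: eq_rsum => x; lra.
  rewrite rsumD; do ?[by move=> x; exact: sqr_ge0].
  rewrite (cpow_double_translate nuB) -(cpow_double1 nuB) -EFinD; congr EFin; lra.
by move=> h; rewrite -[LHS](addeK (x := (2 * c (n + n) g)%:E))// h -EFinB mulrBr.
Qed.

(* AM-GM in the form [|u^2 - v^2| <= (u - v)^2 / (2t) + t (u + v)^2 / 2]. *)
Lemma squared_density_translate n (g : G) A (t : R) : 0 < t ->
  set_mass (squared_density n) [set (g * x)%g | x in A] <=
  set_mass (squared_density n) A + t^-1 * ((a n - c (n + n) g) / a n) + 2 * t.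
Proof.
move=> t0; have an : 0 < a n by exact: cpow_double_gt0 nuB n.
have psd := squared_density_pmf n.
have an' : 0 <= (a n)^-1 by rewrite invr_ge0 ltW.
rewrite -lee_fin set_mass_translate//.
pose d x := (a n)^-1 * (2 * t)^-1 * (c n (g * x)%g - c n x) ^+ 2.
pose s x := t * (squared_density n (g * x)%g + squared_density n x).
have sd0 x : 0 <= squared_density n x by exact: pmf_ge0.
have d0 x : 0 <= d x.
  by rewrite mulr_ge0 ?sqr_ge0// mulr_ge0// invr_ge0 mulr_ge0// ltW.
have s0 x : 0 <= s x by rewrite mulr_ge0 ?addr_ge0// ltW.
apply: (le_trans (y := rsum (fun x => \1_A x * squared_density n x + (d x + s x)))).
  apply: rsum_le => x; rewrite indicE; case: (x \in A); last first.
    by rewrite !mul0r add0r addr_ge0.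
  rewrite !mul1r /d /s /squared_density.
  set u := c n (g * x)%g; set v := c n x; set b := (a n)^-1.
  suff : u ^+ 2 <= v ^+ 2 + ((2 * t)^-1 * (u - v) ^+ 2 + t * (u ^+ 2 + v ^+ 2)).
    move=> /(ler_wpM2l an'); rewrite -/b; lra.
  have h : 0 <= (2 * t)^-1 * ((u - v) - t * (u + v)) ^+ 2.
    by rewrite mulr_ge0 ?sqr_ge0// invr_ge0 mulr_ge0// ltW.
  have E1 : (2 * t)^-1 * ((u - v) - t * (u + v)) ^+ 2 =
      (2 * t)^-1 * (u - v) ^+ 2 - (u ^+ 2 - v ^+ 2) + 2^-1 * t * (u + v) ^+ 2.
    have tt : t * t^-1 = 1 by rewrite divff ?gt_eqF.
    rewrite invfM; set t' := t^-1 in tt *.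
    have -> : (u - v - t * (u + v)) ^+ 2 = (u - v) ^+ 2 - t * (2 * (u ^+ 2 - v ^+ 2))
       + t * t * (u + v) ^+ 2 by lra.
    rewrite mulrDr mulrBr; congr (_ - _ + _).
      transitivity ((t * t') * (u ^+ 2 - v ^+ 2)); last by rewrite tt mul1r.
      lra.
    transitivity ((t * t') * (2^-1 * t * (u + v) ^+ 2)); last by rewrite tt mul1r.
    lra.
  (* This replaces [t (u + v)^2 / 2] by [t (u^2 + v^2)], whose sum is [2 * t] after
     normalization. *)
  have h2 : 0 <= t * (u - v) ^+ 2 by rewrite mulr_ge0 ?sqr_ge0// ltW.
  move: h; rewrite E1; lra.
rewrite rsumD//; do ?[by move=> x; rewrite ?addr_ge0// mulr_ge0].
rewrite rsumD// -set_massE// !EFinD -addeA leeD2l// leeD//.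
  rewrite rsumZ ?cpow_translate_dist//; last 2 first.
  - by rewrite mulr_ge0// invr_ge0 mulr_ge0// ltW.
  - by move=> x; exact: sqr_ge0.
  rewrite -EFinM lee_fin invfM.
  by rewrite le_eqVlt; apply/orP; left; apply/eqP; lra.
rewrite rsumZ ?rsumD//; last 2 first.
- exact: ltW.
- by move=> x; rewrite addr_ge0.
have -> : rsum (fun x => squared_density n (g * x)%g) = rsum (squared_density n).
  by rewrite [RHS](rsum_reindex _ (bij_mulgl g)).
by rewrite pmf_sum// -EFinD -EFinM lee_fin mulrC.
Qed.

End Kesten.

Section KestenTheorem.
Variables (R : realType) (G : groupType) (B : set G) (nu : G -> R).
Hypotheses (nuB : Ps B nu) (Bsym : symmetric_set B) (Bgen : generates B).
Local Notation c := (convolution_power nu).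
Local Notation a n := (c (n + n) 1%g).

Lemma translate_image (g h : G) (A : set G) :
  [set (g * x)%g | x in [set (h * x)%g | x in A]] = [set (g * h * x)%g | x in A].
Proof.
apply/seteqP; split => [_ [_ [x Ax <-] <-]|_ [x Ax <-]].
  by exists x => //; rewrite mulgA.
by exists (h * x)%g; [exists x|rewrite mulgA].
Qed.

Lemma translate1 (A : set G) : [set (1 * x)%g | x in A] = A.
Proof.
apply/seteqP; split => [_ [x Ax <-]|x Ax]; first by rewrite mul1g.
by exists x => //; rewrite mul1g.
Qed.

(* Invariance under products of two elements of B is all that the even powers
   of nu can give; averaging over one translate repairs it. *)
Lemma amenable_even_mean (m : set G -> R) :
  m setT = 1 -> (forall A, 0 <= m A) ->
  (forall A A', A `&` A' = set0 -> m (A `|` A') = m A + m A') ->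
  (forall g h A, B g -> B h -> m [set (g * h * x)%g | x in A] = m A) ->
  amenable R G.
Proof.
move=> m1 m0 mU mB; have [s Bs] := Ps_nonempty nuB.
have transT g : [set (g * x)%g | x in [set: G]] = setT.
  by apply/seteqP; split => // x _; exists (g^-1 * x)%g => //; rewrite mulVKg.
exists (fun A => 2^-1 * (m A + m [set (s * x)%g | x in A])); split.
- by rewrite transT m1; lra.
- by move=> A; rewrite mulr_ge0// addr_ge0.
- move=> A A' AA'; rewrite mU// image_setU mU//; first lra.
  apply/seteqP; split => // _ [[x Ax <-] [y Ay]] /(congr1 (fun z => s^-1 * z)%g).
  by rewrite !mulKg => yx; have : (A `&` A') x; [split=> //; rewrite -yx|rewrite AA'].
move=> g; apply: (generates_ind (P := fun g => forall A,
  2^-1 * (m [set (g * x)%g | x in A] +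
          m [set (s * x)%g | x in [set (g * x)%g | x in A]]) =
  2^-1 * (m A + m [set (s * x)%g | x in A])) Bgen); first split.
- by move=> A; rewrite translate1.
- move=> x y hx hy A; rewrite -[RHS]hy -[RHS]hx (translate_image x y); reflexivity.
- by move=> x hx A; rewrite -hx (translate_image x) mulgV translate1.
move=> b Bb A; congr (_ * _); rewrite translate_image mB// addrC; congr (_ + _).
rewrite -(mB b s^-1%g [set (s * x)%g | x in A])//; last exact: Bsym.
by rewrite translate_image mulgVK.
Qed.

(** Without a uniform ratio, [a n.+1 / a n] comes arbitrarily close to 1. Along such times the gap
    estimate makes the squared densities almost invariant under products of two elements of [B], and
    their ultralimit contradicts non-amenability. *)
Lemma kesten : ~ amenable R G ->
  exists2 rho : R, 0 < rho < 1 & forall n, a n.+1 <= rho * a n.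
Proof.
apply: contra_notP => /forall2NP ex_rho.
have a0 n : 0 < a n by exact: cpow_double_gt0 nuB n.
have nu0 : is_pmf nu := Ps_pmf nuB.
(* The shift to [j.+2] keeps [1 - j.+2%:R^-1] strictly between 0 and 1, as a candidate ratio must
   be. *)
have ex_n j : exists n, (1 - j.+2%:R^-1) * a n < a n.+1.
  have j0 : 0 < j.+2%:R^-1 :> R by rewrite invr_gt0 ltr0n.
  have j1 : j.+2%:R^-1 < 1 :> R by rewrite invf_lt1 ?ltr1n ?ltr0n.
  have [[]|] := ex_rho (1 - j.+2%:R^-1).
    by apply/andP; split; move: j0 j1; set u := _^-1; lra.
  by move=> /existsNP[n /negP]; rewrite -ltNge => h; exists n.
have [n_ nP] := choice ex_n.
pose phi j := squared_density nu (n_ j).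
have phi_pmf j : is_pmf (phi j) by exact: squared_density_pmf nuB _.
have [||| m [m1 m0 mU m_le]] := @ultralimit_mean R G (fun j => set_mass (phi j)).
- by move=> j; exact: set_massT.
- by move=> j A; rewrite set_mass_ge0 ?set_mass_le1.
- by move=> j A A' AA'; rewrite set_massU.
have key g A : 0 < c 2 g -> m [set (g * x)%g | x in A] <= m A.
  move=> cg; apply: m_le => e e0.
  (* The translation estimate is used with [t = e / 4]: its term [2 * t] is [e / 2], and the
     threshold [d0] on [j] bounds the other error by [e / 2]. *)
  have e4 : 0 < e / 4 by lra.
  have lim0 : (fun j => j.+1%:R^-1 : R) @ \oo --> (0 : R) by exact: cvg_harmonic.
  have d0 : 0 < c 2 g * (e / 4) * (e / 2) by rewrite !mulr_gt0//; lra.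
  apply: filterS (cvgr_lt _ lim0 _ d0) => j jd.
  apply: (le_trans (squared_density_translate nuB (n_ j) g A e4)).
  rewrite -addrA; apply: lerD => //.
  suff : (e / 4)^-1 * ((a (n_ j) - c (n_ j + n_ j) g) / a (n_ j)) <= e / 2 by lra.
  rewrite mulrC ler_pdivrMr// ler_pdivrMr// -(ler_pM2l cg).
  apply: (le_trans (cpow_double_gap nuB _ _)).
  apply: (le_trans (y := j.+2%:R^-1 * a (n_ j))).
    have := nP j; set u := _^-1; lra.
  rewrite [leRHS](_ : _ = c 2 g * (e / 4) * (e / 2) * a (n_ j)); last by lra.
  rewrite ler_wpM2r ?(ltW (a0 _))//; apply: le_trans (ltW jd).
  by rewrite lef_pV2 ?posrE ?ltr0n// ler_nat.
apply: (amenable_even_mean m1 m0 mU) => g h A Bg Bh.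
have c2 x y : B x -> B y -> 0 < c 2 (x * y)%g.
  move=> Bx By; apply: lt_le_trans (cpow_mul_ge nu0 1 1 x y).
  by rewrite !cpow1// mulr_gt0// (Ps_gt0 nuB).
(* The reverse inequality is [key] for the inverse of [g * h], which is again a product of two
   elements of [B]. *)
apply/eqP; rewrite eq_le key ?c2//=.
have := key (h^-1 * g^-1)%g [set (g * h * x)%g | x in A].
by rewrite translate_image -invgM mulVg translate1; apply; rewrite invgM c2//; exact: Bsym.
Qed.

(** The decay is written as a square so that it survives multiplication by [rho^-1 ^+ n] as a
    geometric series. *)
Lemma cpow_decay : ~ amenable R G ->
  exists rho : R, [/\ 0 < rho, rho < 1 &
    forall n x, c n x <= rho^-1 ^+ 2 * (rho ^+ n) ^+ 2 ].
Proof.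
move=> /kesten[r /andP[r0 r1] ar].
have nu0 : is_pmf nu := Ps_pmf nuB.
have a_le n : a n <= r ^+ n.
  elim: n => [|n IH]; first by rewrite expr0 /= eqxx.
  by rewrite exprS; apply: le_trans (ar n) _; rewrite ler_wpM2l// ltW.
have even_le n x : c (n + n) x <= r ^+ n.
  exact: le_trans (cpow_double_le nuB n x) (a_le n).
have odd_le n x : c (n + n).+1 x <= r ^+ n.
  rewrite cpowSl// -lee_fin convE//; last exact: cpow_pmf.
  rewrite -(expect_cst nu0); last by rewrite exprn_ge0// ltW.
  by apply: rsum_le => y; rewrite ler_wpM2l// ?pmf_ge0.
(* A fourth root: two steps of the walk gain one factor [r], and the bound is to be a square. The
   prefactor [t^-1 ^+ 2] absorbs the unpaired step of odd times. *)
pose t := Num.sqrt (Num.sqrt r).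
have s0 : 0 < Num.sqrt r by rewrite sqrtr_gt0.
have t0 : 0 < t by rewrite sqrtr_gt0.
have t2 : t ^+ 2 = Num.sqrt r by rewrite sqr_sqrtr// ltW.
have t4 : (t ^+ 2) ^+ 2 = r by rewrite t2 sqr_sqrtr// ltW.
have t1 : t < 1.
  rewrite ltNge; apply/negP => t1; move: r1; rewrite ltNge => /negP; apply.
  by rewrite -t4 exprn_ege1// exprn_ege1.
have tV : 1 <= t^-1 by rewrite invf_ge1// ltW.
exists t; split => // n x.
rewrite -[n]odd_double_half -addnn; set k := n./2.
have rk : r ^+ k = (t ^+ (k + k)) ^+ 2.
  by rewrite -t4 addnn -mul2n (exprM t) exprAC.
case: (odd n); rewrite ?add0n ?add1n.
  apply: (le_trans (odd_le _ _)); rewrite -exprMn (exprS t) mulrA.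
  by rewrite mulVf ?gt_eqF// mul1r rk.
apply: (le_trans (even_le _ _)); rewrite rk ler_peMl ?sqr_ge0//.
by rewrite exprn_ege1.
Qed.

End KestenTheorem.

(** * The Green function *)

Section NatSums.
Variable R : realType.

Lemma rsum_inj_le (T T' : choiceType) (e : T -> T') (f : T' -> R) :
  injective e -> (forall y, 0 <= f y) -> (rsum (f \o e) <= rsum f)%E.
Proof.
move=> e_inj f0; rewrite /rsum -(@esum_image _ _ _ setT e (EFin \o f)).
  rewrite esum_mkcond; apply: le_esum => y _.
  by case: ifP => _; rewrite /= ?lexx// lee_fin.
by move=> x y _ _; exact: e_inj.
Qed.

Lemma rsum_cauchy_product (a b : nat -> R) :
  (forall n, 0 <= a n) -> (forall n, 0 <= b n) ->
  rsum (fun n => \sum_(k < n.+1) a k * b (n - k)%N) = (rsum a * rsum b)%E.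
Proof.
move=> a0 b0; rewrite -rsum_prod//.
transitivity (\esum_(n in [set: nat])
    \esum_(k in `I_n.+1) (a k * b (n - k)%N)%:E).
  apply: eq_esum => n _; rewrite esum_fset//; last first.
    by move=> k _; rewrite lee_fin mulr_ge0.
  by rewrite -fsbig_ord sumEFin.
rewrite esum_esum; last by move=> *; rewrite lee_fin mulr_ge0.
rewrite /rsum (reindex_esum setT _ (fun t : nat * nat => (t.1 + t.2, t.1)%N)).
  by apply: eq_esum => -[k j] _ /=; rewrite addKn.
split.
- by move=> [k j] _ /=; split=> //=; rewrite ltnS leq_addr.
- by move=> [k j] [k' j'] _ _ [] /= + kk; rewrite kk => /eqP; rewrite eqn_add2l => /eqP ->.
- move=> [n k] [_ /=]; rewrite ltnS => kn.
  by exists (k, n - k)%N => //=; rewrite subnKC.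
Qed.

Lemma rsum_geometric_le (t : R) : 0 <= t -> t < 1 ->
  (rsum (fun k : nat => (t ^+ k)%R) <= ((1 - t)^-1)%R%:E)%E.
Proof.
move=> t0 t1; rewrite /rsum -nneseries_esumT; last first.
  by move=> n; rewrite lee_fin exprn_ge0.
apply: lime_le.
  by apply: is_cvg_nneseries => n _ _; rewrite lee_fin exprn_ge0.
apply: nearW => n; rewrite sumEFin lee_fin -[leRHS]mulr1 ler_pdivlMl ?subr_gt0//.
rewrite big_mkord.
have -> : (1 - t) * (\sum_(i < n) t ^+ i) = 1 - t ^+ n.
  by rewrite -opprB mulNr -subrX1 opprB.
by rewrite gerBl exprn_ge0.
Qed.

End NatSums.

(** * First-passage decompositions *)

Section Taboo.
Variables (R : realType) (G : groupType) (nu : G -> R) (x : G).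
Hypothesis nu_pmf : is_pmf nu.
Local Notation c := (convolution_power nu).

(* [taboo k z] is the probability that the walk is at z at time k and has not
   visited x before time k, so that [taboo k x] is the first-passage
   distribution. *)
Fixpoint taboo k : G -> R :=
  if k is j.+1 then convolution (fun y => (y != x)%:R * taboo j y) nu
  else @dirac1 R G.

Lemma taboo_bounds k z : 0 <= taboo k z <= c k z.
Proof.
elim: k z => [|k IH] z; first by rewrite /= lexx ler0n.
have bnd y : 0 <= (y != x)%:R * taboo k y <= c k y.
  case: (y != x); rewrite ?mul1r// mul0r lexx.
  by case/andP: (IH y) => ? /(le_trans _) ->.
rewrite -!lee_fin /= (convE_le _ bnd)//; last exact: cpow_pmf.
rewrite convE//; last exact: cpow_pmf.
rewrite rsum_ge0/= => [|y].
  apply: rsum_le => y; apply: ler_wpM2r; first exact: pmf_ge0.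
  by case/andP: (bnd y).
by rewrite mulr_ge0 ?pmf_ge0//; case/andP: (bnd y).
Qed.

Lemma taboo_ge0 k z : 0 <= taboo k z.
Proof. by case/andP: (taboo_bounds k z). Qed.

(** The walk either avoids [x] before time [n] or is cut at its first visit, at a time [k < n]. In
    the induction, the paths standing at [x] just before the last step supply the new term
    [k = n]. *)
Lemma cpow_first_passage n z :
  c n z = taboo n z + \sum_(k < n) taboo k x * c (n - k) (x^-1 * z)%g.
Proof.
elim: n z => [|n IH] z; first by rewrite big_ord0 addr0.
have c0 m y : 0 <= c m y by exact: cpow_ge0.
have nu0 y : 0 <= nu y by exact: pmf_ge0.
have bnd y : 0 <= (y != x)%:R * taboo n y <= c n y.
  case: (y != x); rewrite ?mul1r ?taboo_bounds// mul0r lexx; exact: c0.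
apply: EFin_inj; rewrite [taboo _ _]/= EFinD (convE_le _ bnd)//; last exact: cpow_pmf.
rewrite cpowS convE//; last exact: cpow_pmf.
have -> : (\sum_(k < n.+1) taboo k x * c (n.+1 - k) (x^-1 * z)%g)%:E =
    (rsum (fun y => (y == x)%:R * (taboo n y * nu (y^-1 * z)%g))%R +
     rsum (fun y => \sum_(k < n) taboo k x *
                     (c (n - k) (x^-1 * y)%g * nu (y^-1 * z)%g))%R)%E.
  rewrite rsum_delta; last by move=> y; rewrite mulr_ge0// taboo_ge0.
  rewrite big_ord_recr/= subSnn cpow1// EFinD addeC; congr (_ + _)%E.
  rewrite -sumEFin /rsum.
  under [RHS]eq_esum => y _ do rewrite -sumEFin.
  rewrite esum_sum; last first.
    by move=> y k _ _; rewrite lee_fin mulr_ge0 ?taboo_ge0// mulr_ge0.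
  apply: eq_bigr => k _; rewrite -[RHS]/(rsum _) rsumZ ?taboo_ge0//; last first.
    by move=> y; rewrite mulr_ge0.
  rewrite EFinM subSn ?(ltnW (ltn_ord k))// cpowS convE//; last exact: cpow_pmf.
  congr (_ * _)%E; rewrite [RHS](rsum_reindex _ (bij_mulgl x)).
  by apply: eq_rsum => y /=; rewrite mulKg invgM mulgA.
have s0 y : 0 <= \sum_(k < n) taboo k x * (c (n - k) (x^-1 * y)%g * nu (y^-1 * z)%g).
  by apply: sumr_ge0 => k _; rewrite mulr_ge0 ?taboo_ge0// mulr_ge0.
have d0 y : 0 <= (y == x)%:R * (taboo n y * nu (y^-1 * z)%g).
  by rewrite !mulr_ge0// taboo_ge0.
have e0 y : 0 <= (y != x)%:R * taboo n y * nu (y^-1 * z)%g.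
  by rewrite !mulr_ge0// taboo_ge0.
rewrite -!rsumD//; last by move=> y; rewrite addr_ge0.
apply: eq_rsum => y; rewrite IH mulrDl addrA; congr (_ + _).
  by case: (y == x); rewrite /=; lra.
by rewrite mulr_suml; apply: eq_bigr => k _; rewrite mulrA.
Qed.

Lemma cpow_renewal n : c n x = \sum_(k < n.+1) taboo k x * c (n - k) 1%g.
Proof.
rewrite cpow_first_passage big_ord_recr/= subnn addrC mulVg; congr (_ + _).
by rewrite /= eqxx mulr1.
Qed.

Lemma cpow_through n y :
  \sum_(k < n.+1) taboo k x * c (n - k) y <= c n (x * y)%g.
Proof.
rewrite cpow_first_passage big_ord_recr/= subnn addrC mulKg lerD2r /=.
have [->|_] := eqVneq y 1%g; first by rewrite mulr1 mulg1.
by rewrite mulr0 taboo_ge0.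
Qed.

End Taboo.

Section Green.
Variables (R : realType) (G : groupType) (B : set G) (nu : G -> R).
Hypotheses (nuB : Ps B nu) (Bsym : symmetric_set B) (Bgen : generates B).
Hypothesis nonamenable : ~ amenable R G.
Local Notation c := (convolution_power nu).

Let nu_pmf : is_pmf nu. Proof. by case: nuB. Qed.
Let c_ge0 n x : 0 <= c n x. Proof. exact: cpow_ge0. Qed.

Definition green x : R := fine (green_function nu x).
Definition green_dist x : R := green_metric nu 1%g x.

Lemma green_functionE x : green_function nu x = rsum (fun n => c n x).
Proof. by rewrite /green_function nneseries_esumT// => n; rewrite lee_fin. Qed.

(** The Green function remains bounded slightly beyond parameter 1, uniformly in [x]. This gives its
    finiteness, and later the comparison of a resolvent with a power of it. *)
Lemma cpow_weighted_sum : exists r A : R, [/\ 1 < r, 0 < A &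
  forall x, (rsum (fun n => r ^+ n * c n x)%R <= A%:E)%E].
Proof.
have [t [t0 t1 ct]] := cpow_decay nuB Bsym Bgen nonamenable.
exists t^-1, (t^-1 ^+ 2 * (1 - t)^-1); split.
- by rewrite invf_gt1.
- by rewrite mulr_gt0 ?invr_gt0 ?subr_gt0// exprn_gt0// invr_gt0.
move=> x.
have A0 : 0 <= t^-1 ^+ 2 by rewrite sqr_ge0.
have ht n : 0 <= t ^+ n by rewrite exprn_ge0// ltW.
apply: (le_trans (y := rsum (fun n => t^-1 ^+ 2 * t ^+ n))).
  apply: rsum_le => n; rewrite [leLHS]mulrC (exprVn t n) ler_pdivrMr ?exprn_gt0//.
  by rewrite -mulrA -expr2.
rewrite rsumZ// [leRHS]EFinM; apply: lee_wpmul2l; first by rewrite lee_fin.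
exact: rsum_geometric_le (ltW t0) t1.
Qed.

Lemma greenE x : (green x)%:E = rsum (fun n => c n x).
Proof.
rewrite /green green_functionE; apply: rsum_fineK => //.
have [r [A [r1 A0 rA]]] := cpow_weighted_sum.
apply: (le_lt_trans _ (ltry A)); apply: le_trans (rA x).
by apply: rsum_le => n; rewrite ler_peMl// exprn_ege1// ltW.
Qed.

Lemma cpow_reaches x : exists n, 0 < c n x.
Proof.
move: x; apply: (generates_ind Bgen); first split.
- by exists 0%N; rewrite /= eqxx ltr01.
- move=> x y [n nx] [m my]; exists (n + m)%N.
  by apply: lt_le_trans (cpow_mul_ge nu_pmf n m x y); rewrite mulr_gt0.
- by move=> x [n nx]; exists n; rewrite (cpow_sym nuB).
by move=> x Bx; exists 1%N; rewrite cpow1// (Ps_gt0 nuB).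
Qed.

Lemma cpow_le_green n x : c n x <= green x.
Proof.
by rewrite -lee_fin greenE; apply: (rsum_ge1 (f := fun n => c n x)).
Qed.

Lemma green_gt0 x : 0 < green x.
Proof. by have [n nx] := cpow_reaches x; apply: lt_le_trans (cpow_le_green n x). Qed.

Lemma green_sym x : green x^-1%g = green x.
Proof.
by apply: EFin_inj; rewrite !greenE; apply: eq_rsum => n; rewrite (cpow_sym nuB).
Qed.

Lemma cpow_mul_green n x y : c n x * green y <= green (x * y)%g.
Proof.
rewrite -lee_fin EFinM !greenE -rsumZ//.
apply: le_trans (rsum_inj_le (e := addn n) _ _) => //; last exact: addnI.
by apply: rsum_le => m /=; exact: cpow_mul_ge.
Qed.

(* Decompose a path through x y at its first visit to x. *)
Lemma green_submul x y : green x * green y <= green 1%g * green (x * y)%g.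
Proof.
pose f n := taboo nu x n x.
have f0 n : 0 <= f n by exact: taboo_ge0.
have Ff : (rsum f < +oo)%E.
  apply: le_lt_trans (ltry (green x)); rewrite greenE; apply: rsum_le => n.
  by case/andP: (taboo_bounds x nu_pmf n x).
have FE := rsum_fineK f0 Ff; set F := fine _ in FE.
have gx : green x = F * green 1%g.
  apply: EFin_inj; rewrite EFinM FE !greenE -rsum_cauchy_product//.
  by apply: eq_rsum => n; exact: cpow_renewal.
have gxy : F * green y <= green (x * y)%g.
  rewrite -lee_fin EFinM FE !greenE -rsum_cauchy_product//.
  by apply: rsum_le => n; exact: cpow_through.
by rewrite gx mulrAC mulrC ler_wpM2l// ltW// green_gt0.
Qed.

Lemma green_distE x : green_dist x = ln (green 1%g) - ln (green x).
Proof. by rewrite /green_dist /green_metric invg1 mul1g. Qed.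

Lemma green_metricE x y : green_metric nu x y = green_dist (x^-1 * y)%g.
Proof. by rewrite green_distE. Qed.

Lemma green_dist1 : green_dist 1%g = 0.
Proof. by rewrite green_distE subrr. Qed.

Lemma green_dist_sym x : green_dist x^-1%g = green_dist x.
Proof. by rewrite !green_distE green_sym. Qed.

Lemma green_dist_triangle x y :
  green_dist (x * y)%g <= green_dist x + green_dist y.
Proof.
have := green_submul x y; rewrite -ler_ln ?posrE ?mulr_gt0 ?green_gt0//.
by rewrite !lnM ?posrE ?green_gt0// !green_distE; lra.
Qed.

Lemma green_dist_ge0 x : 0 <= green_dist x.
Proof.
have := green_dist_triangle x x^-1%g; rewrite mulgV green_dist1 green_dist_sym.
lra.
Qed.

Lemma green_dist_le_cpow n x : 0 < c n x -> green_dist x <= - ln (c n x).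
Proof.
move=> cx; have := cpow_mul_green n x 1%g; rewrite mulg1.
rewrite -ler_ln ?posrE ?mulr_gt0 ?green_gt0//.
by rewrite lnM ?posrE ?green_gt0// green_distE; lra.
Qed.

(** The triangle inequality for multiplication by [x] and by its inverse; the one-step path to [x]
    bounds [green_dist x]. *)
Lemma green_dist_step a x : B x -> `|green_dist (a * x)%g - green_dist a| <= - ln (nu x).
Proof.
move=> Bx; have Dx : green_dist x <= - ln (nu x).
  by have := @green_dist_le_cpow 1 x; rewrite cpow1//; apply; exact: (Ps_gt0 nuB).
have := green_dist_triangle a x.
have := green_dist_triangle (a * x)%g x^-1%g; rewrite mulgK green_dist_sym.
by rewrite ler_norml => h1 h2; apply/andP; split; lra.
Qed.

Lemma green_dist_word (S : set G) : finite_set S ->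
  exists C : R, 0 < C /\ forall x,
    ((green_dist x)%:E <= C%:E * word_metric R S 1%g x)%E.
Proof.
move=> finS.
have [C [C0 SC]] : exists C : R, 0 < C /\ forall s, S s -> green_dist s <= C.
  (* The added 1 makes [C] positive even if every term of the sum is 0, so that it can be divided
     by. *)
  exists (1 + \sum_(s <- fset_set S) green_dist s); split.
    by rewrite ltr_pwDl// sumr_ge0// => s _; exact: green_dist_ge0.
  move=> s Ss; rewrite (big_rem s)/=; last by rewrite in_fset_set// mem_set.
  rewrite addrCA lerDl addr_ge0// sumr_ge0// => t _; exact: green_dist_ge0.
exists C; split=> // x; rewrite muleC -lee_pdivrMr//.
apply: le_ereal_inf_tmp => _ [w [wS wx] <-].
rewrite -EFinM lee_fin ler_pdivrMr//.
move: wx; rewrite invg1 mul1g => <-; elim: w wS => [|s w IH] wS.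
  by rewrite big_nil green_dist1 mul0r.
rewrite big_cons; apply: le_trans (green_dist_triangle _ _) _.
rewrite /= -natr1 mulrDl mul1r addrC lerD//.
  by apply: IH => u uw; apply: wS; rewrite inE uw orbT.
have [|/SC] := wS s (mem_head _ _); first exact: SC.
by rewrite green_dist_sym.
Qed.

End Green.

(** * Entropy *)

Section Fekete.
Variables (R : realType) (a : nat -> R).
Hypotheses (a_ge0 : forall n, 0 <= a n).
Hypothesis a_sub : forall n m, a (n + m)%N <= a n + a m.

Lemma subadditive_mul m q r : a (q * m + r)%N <= q%:R * a m + a r.
Proof.
elim: q => [|q IH]; first by rewrite mul0n mul0r !add0r.
rewrite mulSn -addnA; apply: le_trans (a_sub _ _) _.
by rewrite -natr1 mulrDl mul1r; move: IH; lra.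
Qed.

(** The limit is the infimum of the ratios: [n] is divided by an index whose ratio is nearly
    minimal, and the finitely many remainders contribute a bounded term. *)
Lemma fekete : cvgn (fun n => n%:R^-1 * a n).
Proof.
(* Index 0 is left out: since [0^-1 = 0], it would put the value 0 into [E]. *)
pose E := [set x | exists n : nat, x = n.+1%:R^-1 * a n.+1].
have E0 x : E x -> 0 <= x.
  by move=> [n ->]; rewrite mulr_ge0// invr_ge0 ler0n.
have infE : has_inf E.
  by split; [exists (1%:R^-1 * a 1%N), 0%N|exists 0 => x /E0].
apply/cvg_ex; exists (inf E); apply/cvgrPdist_le => e e0.
have e2 : 0 < e / 2 by lra.
have [_ [m ->] mE] := inf_adherent e2 infE.
pose M := \sum_(r < m.+1) a r.
have aM n : a (n %% m.+1)%N <= M.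
  rewrite /M (bigD1 (Ordinal (ltn_pmod n (ltn0Sn m))))//= lerDl.
  by apply: sumr_ge0.
have cvgM : (fun n : nat => M * n.+1%:R^-1) @ \oo --> M * (0 : R).
  by apply: cvgMr; exact: cvg_harmonic.
rewrite mulr0 in cvgM.
have [N _ HN] := cvgr_lt _ cvgM _ e2.
exists N.+1 => // -[//|n] /= Nn; have {}HN := HN n Nn.
have n0 : 0 < n.+1%:R :> R by rewrite ltr0n.
have : inf E <= n.+1%:R^-1 * a n.+1 by apply: ge_inf; [case: infE|exists n].
suff : n.+1%:R^-1 * a n.+1 <= inf E + e.
  set x := n.+1%:R^-1 * _ => h1 h2.
  by rewrite ler_norml; apply/andP; split; move: h1 h2 e0; lra.
have h := subadditive_mul m.+1 (n.+1 %/ m.+1) (n.+1 %% m.+1).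
rewrite -divn_eq in h.
have m0 : 0 < m.+1%:R :> R by rewrite ltr0n.
have hq : (n.+1 %/ m.+1)%:R * a m.+1 <= n.+1%:R * (m.+1%:R^-1 * a m.+1).
  rewrite mulrA ler_wpM2r// ler_pdivlMr// -natrM ler_nat; exact: leq_divM.
rewrite mulrC ler_pdivrMr//.
have hM : M <= n.+1%:R * (e / 2).
  by rewrite mulrC -ler_pdivrMr// ltW.
have hm : n.+1%:R * (m.+1%:R^-1 * a m.+1) <= n.+1%:R * (inf E + e / 2).
  by rewrite ler_pM2l// ltW.
have := aM n.+1; set N1 := n.+1%:R in hq hM hm *; set u := m.+1%:R^-1 * _ in hq hm.
by move=> hr; apply: (le_trans h); lra.
Qed.

End Fekete.

Section Entropy.
Variables (R : realType) (G : groupType).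
Implicit Types (p q : G -> R).

Lemma entropyE p : entropy p = rsum (fun x => - ln (p x) * p x).
Proof. by []. Qed.

Lemma ln_le_subr1 (x : R) : 0 < x -> ln x <= x - 1.
Proof. by move=> x0; have := expR_ge1Dx (ln x); rewrite lnK ?posrE//; lra. Qed.

Lemma entropy_term_ge0 p x : is_pmf p -> 0 <= - ln (p x) * p x.
Proof.
by move=> pp; rewrite mulr_ge0 ?pmf_ge0// oppr_ge0 ln_le0// pmf_le1.
Qed.

Lemma entropy_ge0 p : is_pmf p -> (0 <= entropy p)%E.
Proof. by move=> pp; apply: rsum_ge0 => x; exact: entropy_term_ge0. Qed.

(** Pointwise [ln t <= t - 1] at [t = q x / p x]. The masses of [p] and [q] are added to the two
    sides, which avoids subtracting extended reals. *)
Lemma gibbs p q : is_pmf p -> (forall x, 0 < q x) -> (rsum q <= 1)%E ->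
  (entropy p <= expect p (fun x => - ln (q x))%R)%E.
Proof.
move=> pp q0 q1; have p0 x := pmf_ge0 x pp.
have q_le1 x : q x <= 1.
  by rewrite -lee_fin; apply: le_trans q1; apply: rsum_ge1 => y; exact: ltW.
have lnq x : 0 <= p x * - ln (q x) by rewrite mulr_ge0// oppr_ge0 ln_le0.
rewrite -(@leeD2rE _ 1%E)//; apply: (@le_trans _ _ (expect p (fun x => - ln (q x))%R + rsum q)%E);
  last by rewrite leeD2l.
rewrite -(pmf_sum pp) entropyE -!rsumD//; last 2 first.
- by move=> x; exact: ltW.
- by move=> x; exact: entropy_term_ge0.
apply: rsum_le => x.
have := p0 x; rewrite le_eqVlt => /predU1P[<-|px].
  by rewrite mulr0 mul0r !add0r ltW.
have := ln_le_subr1 (divr_gt0 (q0 x) px).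
rewrite ln_div ?posrE// -(ler_pM2l px) [leRHS]mulrBr mulr1.
by rewrite (mulrC _ (q x / p x)) divfK ?gt_eqF//; lra.
Qed.

(** The mass of the pair [(x, y)] is at most that of the product [x * y] under the convolution, and
    the entropy of an independent pair is the sum of the entropies. *)
Lemma entropy_conv p q : is_pmf p -> is_pmf q ->
  (entropy (convolution p q) <= entropy p + entropy q)%E.
Proof.
move=> pp pq; have pc := conv_pmf pp pq.
have p0 x := pmf_ge0 x pp; have q0 x := pmf_ge0 x pq.
have Hp x := entropy_term_ge0 x pp; have Hq x := entropy_term_ge0 x pq.
rewrite entropyE (eq_rsum (g := fun x => convolution p q x * - ln (convolution p q x))); last first.
  by move=> x; rewrite mulrC.
rewrite -/(expect _ _) expect_conv//; last first.
  by move=> x; rewrite oppr_ge0 ln_le0// pmf_le1.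
rewrite -[entropy p]mule1 -[entropy q]mul1e -{1}(pmf_sum pq) -(pmf_sum pp).
rewrite !entropyE -!rsum_prod// -rsumD; last 2 first.
- by move=> t; rewrite mulr_ge0.
- by move=> t; rewrite mulr_ge0.
apply: rsum_le => -[x y] /=.
have := p0 x; rewrite le_eqVlt => /predU1P[<-|px]; first by rewrite !(mul0r, mulr0) addr0.
have := q0 y; rewrite le_eqVlt => /predU1P[<-|qy]; first by rewrite !(mul0r, mulr0) addr0.
have pxy : 0 < p x * q y by rewrite mulr_gt0.
have := conv_ge x y pp pq; rewrite -ler_ln ?posrE//; last first.
  exact: lt_le_trans pxy (conv_ge x y pp pq).
rewrite lnM ?posrE// -(ler_pM2l pxy).
set l := ln (convolution _ _ _); lra.
Qed.

Lemma entropy_dirac1 : entropy (@dirac1 R G) = 0%E.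
Proof.
rewrite /entropy esum1// => x _; rewrite /dirac1; congr EFin.
by case: (x == 1%g); rewrite ?mulr0// ln1 oppr0 mul0r.
Qed.

Variable p : G -> R.
Hypotheses (pp : is_pmf p) (Hp : (entropy p < +oo)%E).
Local Notation c := (convolution_power p).

Lemma entropy_cpow_fin n : (entropy (c n) < +oo)%E.
Proof.
elim: n => [|n IH]; first by rewrite entropy_dirac1.
rewrite cpowS; apply: le_lt_trans (entropy_conv _ pp) _; first exact: cpow_pmf.
exact: lte_add_pinfty.
Qed.

Lemma entropy_cpow_fineK n : (fine (entropy (c n)))%:E = entropy (c n).
Proof.
by rewrite fineK// ge0_fin_numE ?entropy_cpow_fin// entropy_ge0//; exact: cpow_pmf.
Qed.

Lemma entropy_rate_cvg : cvgn (entropy_rate p).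
Proof.
apply: fekete => [n|n m].
  by rewrite fine_ge0// entropy_ge0//; exact: cpow_pmf.
rewrite -lee_fin EFinD !entropy_cpow_fineK cpowD//.
by apply: entropy_conv; exact: cpow_pmf.
Qed.

End Entropy.

(** * Entropy against expected Green distance *)

Section EntropyGreen.
Variables (R : realType) (G : groupType) (B : set G) (nu : G -> R).
Hypotheses (nuB : Ps B nu) (Bsym : symmetric_set B) (Bgen : generates B).
Hypothesis nonamenable : ~ amenable R G.
Local Notation c := (convolution_power nu).
Local Notation D := (green_dist nu).

Let nu_pmf : is_pmf nu. Proof. by case: nuB. Qed.
Let c_ge0 n x : 0 <= c n x. Proof. exact: cpow_ge0. Qed.

Lemma expect_green_le_entropy n : (expect (c n) D <= entropy (c n))%E.
Proof.
apply: rsum_le => x; have := c_ge0 n x; rewrite le_eqVlt => /predU1P[<-|cx].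
  by rewrite mul0r mulr0.
by rewrite mulrC ler_wpM2r// (green_dist_le_cpow nuB).
Qed.

(* The resolvent sum_n u^n nu^n with u = r^(-eta) is comparable with the
   (1 + eta)-th power of the Green function: with b = G(x) / (2 A) the weights
   satisfy 1 <= b^(-eta) u^n + b r^n for every n, and the second part
   contributes at most G(x) / 2. *)
Lemma entropy_le_green (eta : R) : 0 < eta ->
  exists C : R, 0 <= C /\ forall p, is_pmf p ->
    (entropy p <= (1 + eta)%R%:E * expect p D + C%:E)%E.
Proof.
move=> eta0.
have [r [A [r1 A0 rA]]] := cpow_weighted_sum nuB Bsym Bgen nonamenable.
have r0 : 0 < r by exact: lt_trans r1.
pose u := r `^ (- eta).
have u0 : 0 < u by exact: powR_gt0.
have u1 : u < 1.
  rewrite -ltr_ln ?posrE// ln1 ln_powR mulNr oppr_lt0 mulr_gt0//.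
  by rewrite ln_gt0.
have g0 x := green_gt0 nuB Bsym Bgen nonamenable x.
pose Q x := fine (rsum (fun n => u ^+ n * c n x)).
have QE x : (Q x)%:E = rsum (fun n => u ^+ n * c n x).
  apply: rsum_fineK => [n|]; first by rewrite mulr_ge0// exprn_ge0// ltW.
  apply: le_lt_trans (ltry (green nu x)).
  rewrite (greenE nuB)//; apply: rsum_le => n.
  by rewrite ler_piMl// exprn_ile1// ltW.
have Q_le x : green nu x <= 2 * (green nu x / (2 * A)) `^ (- eta) * Q x.
  set b := green nu x / (2 * A).
  have b0 : 0 < b by rewrite divr_gt0// mulr_gt0.
  (* With [y = b * r ^+ n] the two weights are [y ^ (-eta)] and [y], and one of them is at least
     1. *)
  have weights n : 1 <= b `^ (- eta) * u ^+ n + b * r ^+ n.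
    have y0 : 0 < b * r ^+ n by rewrite mulr_gt0// exprn_gt0.
    have -> : b `^ (- eta) * u ^+ n = (b * r ^+ n) `^ (- eta).
      rewrite powRM ?exprn_ge0 ?(ltW b0) ?(ltW r0)//; congr (_ * _).
      rewrite -powR_mulrn ?powR_ge0// -(powR_mulrn n (ltW r0)) /u -!powRrM.
      by rewrite mulrC.
    have [y1|y1] := leP 1 (b * r ^+ n); first by rewrite ler_wpDl// powR_ge0.
    rewrite ler_wpDr ?(ltW y0)// -ler_ln ?posrE ?powR_gt0// ln1 ln_powR.
    by rewrite mulr_le0 ?oppr_le0 ?ln_le0 ?(ltW eta0) ?(ltW y1).
  have : ((green nu x)%:E <= (b `^ (- eta) * Q x + b * A)%R%:E)%E.
    rewrite EFinD (EFinM _ (Q x)) (EFinM b) QE (greenE nuB)//.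
    apply: (le_trans (y := (rsum (fun n => b `^ (- eta) * (u ^+ n * c n x))%R +
       rsum (fun n => b * (r ^+ n * c n x))%R)%E)).
      rewrite -rsumD; last 2 first.
      - by move=> n; rewrite !mulr_ge0 ?powR_ge0 ?c_ge0 ?exprn_ge0 ?(ltW u0).
      - by move=> n; rewrite mulr_ge0 ?(ltW b0)// mulr_ge0// exprn_ge0// ltW.
      by apply: rsum_le => n; rewrite !mulrA -mulrDl ler_peMl.
    rewrite rsumZ ?powR_ge0//; last by move=> n; rewrite mulr_ge0// exprn_ge0// ltW.
    rewrite rsumZ ?(ltW b0)//; last by move=> n; rewrite mulr_ge0// exprn_ge0// ltW.
    by apply: leeD => //; apply: lee_wpmul2l => //; rewrite lee_fin ltW.
  rewrite lee_fin.
  have -> : b * A = green nu x / 2 by rewrite /b invfM mulrA mulfVK// gt_eqF.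
  lra.
have Q0 x : 0 < Q x.
  have := lt_le_trans (g0 x) (Q_le x); rewrite pmulr_rgt0// mulr_gt0// powR_gt0//.
  by rewrite divr_gt0// mulr_gt0.
(* Each power of [nu] has mass 1, so the mass of [Q] is a geometric series in [u]; this is where
   [u < 1] is needed. *)
pose q x := (1 - u) * Q x.
have q0 x : 0 < q x by rewrite mulr_gt0// subr_gt0.
have q1 : (rsum q <= 1)%E.
  rewrite rsumZ ?subr_ge0 ?(ltW u1)//; last by move=> x; exact: ltW.
  have -> : rsum Q = rsum (fun n => u ^+ n).
    rewrite /rsum; under eq_esum => x _ do rewrite QE.
    rewrite rsum_swap; last by move=> x n; rewrite mulr_ge0// exprn_ge0// ltW.
    apply: eq_esum => n _; rewrite rsumZ ?exprn_ge0 ?(ltW u0)//.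
    by rewrite pmf_sum ?mule1//; exact: cpow_pmf.
  apply: (@le_trans _ _ ((1 - u)%R%:E * ((1 - u)^-1)%R%:E)%E).
    rewrite lee_wpmul2l ?lee_fin ?subr_ge0 ?(ltW u1)//.
    exact: rsum_geometric_le (ltW u0) u1.
  by rewrite -EFinM divff// subr_eq0 gt_eqF.
(* What the logarithm of [Q_le] leaves of [- ln (q x)] beside [(1 + eta) * D x]. The absolute value
   secures a nonnegative constant. *)
pose K := - ln (1 - u) + ln 2 + eta * ln (2 * A) - (1 + eta) * ln (green nu 1%g).
exists `|K|; split => // p pp.
apply: le_trans (gibbs pp q0 q1) _.
have D0 x : 0 <= D x by exact: (green_dist_ge0 nuB).
rewrite -(expect_cst pp (normr_ge0 K))// /expect -rsumZ ?addr_ge0 ?(ltW eta0)//; last first.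
  by move=> x; rewrite mulr_ge0// pmf_ge0.
rewrite -rsumD; last 2 first.
- move=> x; rewrite mulr_ge0 ?addr_ge0 ?(ltW eta0)//.
  by rewrite mulr_ge0// pmf_ge0.
- by move=> x; rewrite mulr_ge0// pmf_ge0.
apply: rsum_le => x; rewrite mulrCA -mulrDr ler_wpM2l ?pmf_ge0//.
apply: (@le_trans _ _ ((1 + eta) * D x + K)); last by rewrite lerD2l ler_norm.
have := Q_le x; rewrite -ler_ln ?posrE ?mulr_gt0 ?powR_gt0 ?divr_gt0 ?mulr_gt0//.
rewrite !lnM ?posrE ?mulr_gt0 ?powR_gt0 ?divr_gt0 ?mulr_gt0 ?subr_gt0//.
rewrite ln_powR ln_div ?posrE ?mulr_gt0//.
by rewrite (green_distE nu x) /K; lra.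
Qed.

Lemma moment_green_fin p : finite_first_moment p -> is_pmf p ->
  (expect p D < +oo)%E.
Proof.
move=> [S [finS Sgen Smom]] pp.
have [C [C0 DC]] := green_dist_word nuB Bsym Bgen nonamenable finS.
have p0 x := pmf_ge0 x pp.
have w0 x : (0 <= word_metric R S 1%g x)%E.
  by apply: le_ereal_inf_tmp => _ [w _ <-]; rewrite lee_fin.
apply: (@le_lt_trans _ _ (C%:E * \esum_(x in [set: G]) (word_metric R S 1%g x * (p x)%:E))%E).
  rewrite -esumZl ?(ltW C0)//; last by move=> x; rewrite mule_ge0// lee_fin.
  apply: le_esum => x _; rewrite mulrC EFinM muleA.
  by apply: lee_wpmul2r; rewrite ?lee_fin.
by rewrite lte_mul_pinfty// ?lee_fin ?(ltW C0)// ltW.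
Qed.

End EntropyGreen.

(** * The law of the walk *)

Lemma pmf_support_countable (R : realType) (T : choiceType) (p : T -> R) :
  (forall x, 0 <= p x) -> (rsum p <= 1)%E -> countable [set x | p x != 0].
Proof.
move=> p0 p1.
have -> : [set x | p x != 0] = \bigcup_(k in [set: nat]) [set x | k.+1%:R^-1 < p x].
  apply/seteqP; split => [x /= px|x [k _ /= px]]; last first.
    by rewrite gt_eqF// (lt_trans _ px)// invr_gt0 ltr0n.
  have {}px : 0 < p x by rewrite lt0r px p0.
  exists (Num.truncn (p x)^-1) => //=.
  rewrite invf_plt ?posrE//.
  by rewrite truncnS_gt.
apply: bigcup_countable => // k _; apply: finite_set_countable.
apply: contrapT => /(infinite_set_fset k.+2)[F FA kF].
have := le_trans (rsum_ge_fset p F) p1; rewrite lee_fin leNgt => /negP; apply.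
apply: (@lt_le_trans _ _ (k.+2%:R * k.+1%:R^-1)).
  by rewrite ltr_pdivlMr ?mul1r ?ltr_nat ?ltr0n.
apply: (@le_trans _ _ (\sum_(x <- F) k.+1%:R^-1)).
  rewrite big_const_seq count_predT iter_addr_0 -[leRHS]mulr_natl.
  by rewrite ler_wpM2r ?invr_ge0// ler_nat.
by rewrite big_seq [leRHS]big_seq; apply: ler_sum => x /FA /ltW.
Qed.

Section WalkLaw.
Variables (R : realType) (G : groupType).
Variables (disp : measure_display) (Omega : measurableType disp).
Hypothesis Gcount : countable [set: G].

Lemma measurable_discrete2 (T1 T2 : Type) (Z1 : Omega -> T1) (Z2 : Omega -> T2) :
  countable [set: T1] -> countable [set: T2] ->
  (forall A, measurable (Z1 @^-1` A)) -> (forall A, measurable (Z2 @^-1` A)) ->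
  forall A, measurable ((fun w => (Z1 w, Z2 w)) @^-1` A).
Proof.
move=> c1 c2 m1 m2 A.
have -> : (fun w => (Z1 w, Z2 w)) @^-1` A =
    \bigcup_t (Z1 @^-1` [set t] `&` Z2 @^-1` [set u | A (t, u)]).
  by apply/seteqP; split => [w Aw|w [t _ [/= <-]]//]; exists (Z1 w).
apply: countable_bigcupT_measurable => // t; exact: measurableI.
Qed.

Variables (P : probability Omega R) (X : nat -> Omega -> G) (nu : G -> R).
Hypotheses (nu_pmf : is_pmf nu) (X_iid : iid_of_law P X nu).
Local Notation c := (convolution_power nu).

Definition increment b m w : G := (\prod_(i < m) X (b + i)%N w)%g.

Lemma walk_increment n w : walk X n w = increment 0 n w.
Proof. by []. Qed.

Lemma incrementS b m w : increment b m.+1 w = (increment b m w * X (b + m)%N w)%g.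
Proof. by rewrite /increment big_ord_recr. Qed.

Lemma walkD n m w : walk X (n + m) w = (walk X n w * increment n m w)%g.
Proof.
elim: m => [|m IH]; first by rewrite addn0 /increment big_ord0 mulg1.
by rewrite addnS walk_increment incrementS -walk_increment IH incrementS mulgA.
Qed.

Let mX i A : measurable (X i @^-1` A). Proof. by case: X_iid. Qed.

Lemma measurable_increment b m A : measurable (increment b m @^-1` A).
Proof.
elim: m A => [|m IH] A.
  have -> : increment b 0 = fun=> 1%g by apply/funext => w; rewrite /increment big_ord0.
  by rewrite preimage_cst; case: ifP => _; [exact: measurableT|exact: measurable0].
have -> : increment b m.+1 @^-1` A =
    (fun w => (increment b m w, X (b + m)%N w)) @^-1` [set t | A (t.1 * t.2)%g].
  by apply/seteqP; split => w /=; rewrite incrementS.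
exact: measurable_discrete2.
Qed.

Lemma measurable_walk n A : measurable (walk X n @^-1` A).
Proof. exact: (measurable_increment 0). Qed.

Definition cylinder (J : {fset nat}) (A : nat -> set G) : set Omega :=
  \bigcap_(i in [set` J]) X i @^-1` A i.

Lemma measurable_cylinder J A : measurable (cylinder J A).
Proof. by apply: bigcap_measurableType => i _; exact: mX. Qed.

Lemma cylinder_add (b : nat) (J : {fset nat}) A z : b \notin J ->
  let A' i := if i == b then [set z] else A i in
  cylinder (b |` J)%fset A' = X b @^-1` [set z] `&` cylinder J A /\
  P (cylinder (b |` J)%fset A') = ((nu z)%:E * P (cylinder J A))%E.
Proof.
move=> bJ A'; have A'J i : i \in J -> A' i = A i.
  by rewrite /A'; case: eqP => // -> bJ'; rewrite bJ' in bJ.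
split.
  apply/seteqP; split => w.
    move=> h; split; first by have := h b; rewrite /A' eqxx; apply; rewrite /= fset1U1.
    by move=> i iJ; rewrite /= -A'J//; apply: h; rewrite /= fset1Ur.
  move=> [hb hJ] i /= /fset1UP[->|iJ]; first by rewrite /A' eqxx.
  by rewrite A'J//; exact: hJ.
case: X_iid => _ Xlaw Xind; rewrite /cylinder !Xind big_fsetU1//= /A' eqxx Xlaw.
congr (_ * _)%E; apply: eq_big_seq => i iJ; rewrite -/(A' i) A'J//.
Qed.

(** The induction moves the last increment into the cylinder of later ones. Since [E] enters only
    through its product bound with later cylinders, the lemma applies twice: to [setT] for the walk
    up to time [n], then to an event of that walk for the next [m] steps. A lower bound suffices,
    and it is reached through finite subsums. *)
Lemma increment_law (E : set Omega) (b m : nat) (a : R) y J A :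
  measurable E -> 0 <= a ->
  (forall (J : {fset nat}) A, (forall i, i \in J -> (b <= i)%N) ->
    (a%:E * P (cylinder J A) <= P (E `&` cylinder J A))%E) ->
  (forall i, i \in J -> (b + m <= i)%N) ->
  ((a * c m y)%:E * P (cylinder J A) <=
   P (E `&` increment b m @^-1` [set y] `&` cylinder J A))%E.
Proof.
move=> mE a0 hE; elim: m y J A => [|m IH] y J A hJ.
  rewrite /=; have [->|y1] := eqVneq y 1%g; last by rewrite mulr0 mul0e.
  rewrite mulr1; have -> : increment b 0 @^-1` [set 1%g] = setT.
    by apply/seteqP; split => // w _; rewrite /increment /= big_ord0.
  by rewrite setIT; apply: hE => i /hJ; rewrite addn0.
have bJ : (b + m)%N \notin J by apply/negP => /hJ; rewrite addnS ltnn.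
have mcyl := measurable_cylinder.
set pJ := P (cylinder J A).
have pJ_fin : pJ \is a fin_num by exact: fin_num_measure.
have pJ0 : 0 <= fine pJ by rewrite fine_ge0// measure_ge0.
have c0 k x : 0 <= c k x by exact: cpow_ge0.
have t0 z : 0 <= c m z * nu (z^-1 * y)%g by rewrite mulr_ge0// pmf_ge0.
have -> : ((a * c m.+1 y)%:E * pJ)%E =
    rsum (fun z => (a * fine pJ) * (c m z * nu (z^-1 * y)%g)).
  rewrite rsumZ ?mulr_ge0// -convE//; last exact: cpow_pmf.
  by rewrite -[pJ in LHS]fineK// -!EFinM mulrAC.
apply: rsum_fset_le => F; rewrite -sumEFin.
(* The target event is split according to the value [z] of the product before its last increment. *)
pose H z := E `&` increment b m @^-1` [set z] `&`
  (X (b + m)%N @^-1` [set (z^-1 * y)%g] `&` cylinder J A).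
have mH z : measurable (H z).
  apply: measurableI; apply: measurableI => //.
  exact: measurable_increment.
have HF z : (((a * fine pJ) * (c m z * nu (z^-1 * y)%g))%:E <= P (H z))%E.
  have [eqC PC] := cylinder_add A (z^-1 * y)%g bJ.
  rewrite /H -eqC; apply: le_trans (IH z _ _ _); last first.
    by move=> i /fset1UP[->//|/hJ]; rewrite addnS => /ltnW.
  rewrite PC -/pJ -[pJ in leRHS]fineK// -!EFinM lee_fin.
  by rewrite le_eqVlt; apply/orP; left; apply/eqP; lra.
apply: (@le_trans _ _ (\sum_(z <- F) P (H z))%E); first exact: lee_sum.
have trivH : trivIset [set` F] H.
  move=> z1 z2 _ _ [w [[[_ /= h1] _] [[_ /= h2] _]]].
  by rewrite -h1 -h2.
have -> : (\sum_(z <- F) P (H z))%E = P (\bigcup_(z in [set` F]) H z).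
  by rewrite measure_fin_bigcup// fsbig_finite//= set_fsetK.
apply: le_measure; rewrite ?inE.
- by apply: fin_bigcup_measurable.
- apply: measurableI => //; apply: measurableI => //; exact: measurable_increment.
move=> w [z _ [[Ew /= wz] [/= Xw Jw]]]; split=> //; split=> //=.
by rewrite incrementS wz Xw mulVKg.
Qed.

Lemma walk_increment_law n m x y :
  ((c n x * c m y)%:E <=
   P (walk X n @^-1` [set x] `&` increment n m @^-1` [set y]))%E.
Proof.
have cyl0 A : cylinder fset0 A = setT.
  by apply/seteqP; split => // w _ i.
have h1 (J : {fset nat}) A : (forall i, i \in J -> (n <= i)%N) ->
    ((c n x)%:E * P (cylinder J A) <= P (walk X n @^-1` [set x] `&` cylinder J A))%E.
  move=> hJ; rewrite -[c n x]mul1r -[walk X n @^-1` _]setTI.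
  apply: (@increment_law setT 0 n 1) => //.
  by move=> J' A' _; rewrite mul1e setTI.
have mE := measurable_walk n [set x].
have J0 (i : nat) : i \in (fset0 : {fset nat}) -> (n + m <= i)%N by rewrite in_fset0.
have := @increment_law _ n m _ y _ (fun=> setT) mE (cpow_ge0 nu_pmf n x) h1 J0.
by rewrite cyl0 probability_setT mule1 setIT.
Qed.

(** Only this direction is needed to carry the deviation bound from integrals on [Omega] to sums
    over [G * G]: on finitely many disjoint events the integrand is constant. *)
Lemma le_expect_walk n m (Phi : G -> G -> R) : (forall x y, 0 <= Phi x y) ->
  (rsum (fun t : G * G => c n t.1 * c m t.2 * Phi t.1 t.2)%R <=
   \int[P]_(w in [set: Omega]) (Phi (walk X n w) (increment n m w))%:E)%E.
Proof.
move=> Phi0; pose f w := (Phi (walk X n w) (increment n m w))%:E.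
have mf : measurable_fun setT f.
  move=> _ Y mY; rewrite setTI.
  have -> : f @^-1` Y = (fun w => (walk X n w, increment n m w)) @^-1`
    [set t | Y (Phi t.1 t.2)%:E] by [].
  exact: measurable_discrete2 Gcount Gcount (measurable_walk n) (measurable_increment n m) _.
apply: rsum_fset_le => F.
pose H (t : G * G) := walk X n @^-1` [set t.1] `&` increment n m @^-1` [set t.2].
have mH t : measurable (H t).
  by apply: measurableI; [exact: measurable_walk|exact: measurable_increment].
have trivH : trivIset [set` F] H.
  by move=> [x1 y1] [x2 y2] _ _ [w [[/= <- <-] [/= <- <-]]].
apply: (@le_trans _ _ (\int[P]_(w in \big[setU/set0]_(t <- F) H t) f w)%E); last first.
  apply: ge0_subset_integral => //.
  - by apply: bigsetU_measurable.
  - by move=> w _; rewrite lee_fin.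
rewrite ge0_integral_bigsetU//; last first.
- by move=> w _; rewrite lee_fin.
- exact: measurable_funTS.
rewrite -sumEFin; apply: lee_sum => t _.
rewrite (eq_integral (cst (Phi t.1 t.2)%:E)); last first.
  by move=> w; rewrite inE => -[/= h1 h2]; rewrite /f h1 h2.
rewrite integral_cst// EFinM muleC lee_wpmul2l ?lee_fin//.
exact: walk_increment_law.
Qed.

End WalkLaw.

(** * Replacing increments *)

Section Step.
Variables (R : realType) (G : groupType).

Lemma expect_conv3 (p nu q : G -> R) (Phi : G -> G -> R) :
  is_pmf p -> is_pmf nu -> is_pmf q -> (forall x y, 0 <= Phi x y) ->
  rsum (fun t : G * G => convolution p nu t.1 * q t.2 * Phi t.1 t.2) =
  rsum (fun t : (G * G) * G =>
          p t.1.1 * nu t.1.2 * q t.2 * Phi (t.1.1 * t.1.2)%g t.2).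
Proof.
move=> pp pnu pq Phi0.
have pc := conv_pmf pp pnu.
have p0 x := pmf_ge0 x pp; have nu0 x := pmf_ge0 x pnu.
have q0 x := pmf_ge0 x pq; have c0 x := pmf_ge0 x pc.
rewrite [LHS]rsum_pair/=; last by move=> t; rewrite !mulr_ge0.
rewrite [RHS]rsum_pair/=; last by move=> t; rewrite !mulr_ge0.
rewrite [LHS]rsum_swap/=; last by move=> *; rewrite !mulr_ge0.
rewrite [RHS]rsum_swap/=; last by move=> *; rewrite !mulr_ge0.
apply: eq_esum => b _ /=.
transitivity (expect (convolution p nu) (fun x => q b * Phi x b)).
  by apply: eq_rsum => x; rewrite mulrA.
rewrite expect_conv//; last by move=> x; rewrite mulr_ge0.
by apply: eq_rsum => t; rewrite mulrA.
Qed.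

Lemma rsum_middle (f : G -> R) (g : G -> G -> R) :
  (forall x, 0 <= f x) -> (forall x y, 0 <= g x y) ->
  rsum (fun t : (G * G) * G => f t.1.2 * g t.1.1 t.2) =
  (rsum f * rsum (fun t : G * G => g t.1 t.2))%E.
Proof.
move=> f0 g0; rewrite -rsum_prod//.
rewrite (rsum_reindex (e := fun t : (G * G) * G => (t.1.2, (t.1.1, t.2))))//.
by exists (fun t => ((t.2.1, t.1), t.2.2)) => [[[]]|[? []]].
Qed.

Variables (B : set G) (nu nu' : G -> R) (D L : G -> R) (eps Dv M : R).
Hypotheses (nuB : Ps B nu) (nu'B : Ps B nu').
Hypotheses (D0 : forall x, 0 <= D x) (L0 : forall x, 0 <= L x).
Hypothesis D_triangle : forall x y, D (x * y)%g <= D x + D y.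
Hypothesis D_step : forall a x, B x -> `|D (a * x)%g - D a| <= L x.
Hypotheses (eps0 : 0 <= eps) (Dv0 : 0 <= Dv) (M0 : 0 <= M).
Hypotheses (nu'_le : forall x, nu' x <= (1 + eps) * nu x).
Hypotheses (nu_le : forall x, nu x <= (1 + eps) * nu' x).
Hypothesis LM : (expect nu L <= M%:E)%E.
Hypothesis LM' : (expect nu' L <= M%:E)%E.
Local Notation c := (convolution_power nu).
Local Notation c' := (convolution_power nu').
Hypothesis dev : forall n m,
  (rsum (fun t : G * G => c n t.1 * c m t.2 * (D t.1 + D t.2 - D (t.1 * t.2)%g))%R
    <= Dv%:E)%E.

Let pnu : is_pmf nu. Proof. by case: nuB. Qed.
Let pnu' : is_pmf nu'. Proof. by case: nu'B. Qed.
Let pc n : is_pmf (c n). Proof. exact: cpow_pmf. Qed.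
Let pc' n : is_pmf (c' n). Proof. exact: cpow_pmf. Qed.
Let c0 n x : 0 <= c n x. Proof. exact: cpow_ge0. Qed.
Let c'0 n x : 0 <= c' n x. Proof. exact: cpow_ge0. Qed.
Let gap0 x y : 0 <= D x + D y - D (x * y)%g.
Proof. by rewrite subr_ge0. Qed.

(* With [rest = D a + D b + L x - D (a x b) >= 0], the expectation of
   [D a + D b] does not see the law of the middle increment x, so only the
   bounded expectations of [rest] and [L] are affected by replacing it. *)
Lemma replace_increment k m :
  (expect (convolution (convolution (c' k) nu') (c m)) D <=
   expect (convolution (convolution (c' k) nu) (c m)) D +
   (eps * ((1 + eps) ^+ k.+1 * Dv + 3 * M))%:E)%E.
Proof.
have nu0 x : 0 <= nu x by exact: pmf_ge0.
have nu'0 x : 0 <= nu' x by exact: pmf_ge0.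
have eps1 : 0 <= 1 + eps by rewrite addr_ge0.
pose rest (t : (G * G) * G) :=
  D t.1.1 + D t.2 + L t.1.2 - D (t.1.1 * t.1.2 * t.2)%g.
pose w (z : G -> R) (t : (G * G) * G) := c' k t.1.1 * z t.1.2 * c m t.2.
have w0 z t : (forall x, 0 <= z x) -> 0 <= w z t by move=> z0; rewrite !mulr_ge0.
have rest0 t : B t.1.2 -> 0 <= rest t.
  case: t => [[a x] b] /= Bx; have := D_step a Bx; rewrite ler_norml => /andP[_].
  by have := D_triangle (a * x)%g b; rewrite /rest/=; lra.
have wrest0 z t : Ps B z -> 0 <= w z t * rest t.
  move=> zB; have [Bx|nBx] := pselect (B t.1.2).
    by rewrite mulr_ge0 ?rest0// w0// => x; apply: pmf_ge0; case: zB.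
  by rewrite /w (Ps_eq0 zB nBx) mulr0 !mul0r.
pose U := rsum (fun t : G * G => c' k t.1 * c m t.2 * (D t.1 + D t.2)).
(* An identity between sums, since [U] is not known to be finite here; the only quantity cancelled
   later is the bounded [r']. *)
have split_sum z : Ps B z ->
    (expect (convolution (convolution (c' k) z) (c m)) D + rsum (fun t => w z t * rest t)%R =
     U + expect z L)%E.
  move=> zB; have pz : is_pmf z by case: zB.
  have z0 x : 0 <= z x by exact: pmf_ge0.
  rewrite expect_conv//; last exact: conv_pmf.
  rewrite (expect_conv3 (Phi := fun x y => D (x * y)%g))//.
  rewrite -rsumD; last 2 first.
  - by move=> t; rewrite !mulr_ge0.
  - by move=> t; exact: wrest0.
  rewrite -[U]mul1e -(pmf_sum pz) /U.
  rewrite -(rsum_middle (g := fun x y => c' k x * c m y * (D x + D y)))//; last first.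
    by move=> x y; rewrite !mulr_ge0// addr_ge0.
  have -> : expect z L = rsum (fun t : (G * G) * G =>
      (z t.1.2 * L t.1.2) * (c' k t.1.1 * c m t.2)).
    rewrite (rsum_middle (f := fun x => z x * L x) (g := fun x y => c' k x * c m y)).
    - by rewrite (rsum_prod (c'0 k) (c0 m)) (pmf_sum (pc' k)) (pmf_sum (pc m)) !mule1.
    - by move=> x; rewrite mulr_ge0.
    - by move=> x y; rewrite mulr_ge0.
  rewrite -rsumD; last 2 first.
  - by move=> t; rewrite !mulr_ge0// addr_ge0.
  - by move=> t; rewrite !mulr_ge0.
  by apply: eq_rsum => t; rewrite /w /rest; lra.
(* The deviation bound concerns walks with one law throughout. Turning the first [k.+1] increments
   from [nu'] into [nu] costs the power of [1 + eps]. The third [M] of the statement comes from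
   [L_le]. *)
pose rho := (1 + eps) ^+ k.+1 * Dv + 2 * M.
have rest_le : (rsum (fun t => w nu' t * rest t)%R <= rho%:E)%E.
  have LE : rsum (fun t => w nu' t * (2 * L t.1.2)) = (2%:E * expect nu' L)%E.
    rewrite -rsumZ//; last by move=> x; rewrite mulr_ge0.
    transitivity (rsum (fun t : (G * G) * G =>
      (2 * (nu' t.1.2 * L t.1.2)) * (c' k t.1.1 * c m t.2))).
      by apply: eq_rsum => t; rewrite /w; lra.
    rewrite (rsum_middle (f := fun x => 2 * (nu' x * L x)) (g := fun x y => c' k x * c m y)).
    - by rewrite (rsum_prod (c'0 k) (c0 m)) (pmf_sum (pc' k)) (pmf_sum (pc m)) !mule1.
    - by move=> x; rewrite !mulr_ge0.
    - by move=> x y; rewrite mulr_ge0.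
  pose gap (t : (G * G) * G) :=
    D (t.1.1 * t.1.2)%g + D t.2 - D (t.1.1 * t.1.2 * t.2)%g.
  have gapE : rsum (fun t => w nu' t * gap t) =
      rsum (fun t : G * G => c' k.+1 t.1 * c m t.2 * (D t.1 + D t.2 - D (t.1 * t.2)%g)).
    by rewrite (expect_conv3 (Phi := fun x y => D x + D y - D (x * y)%g)).
  apply: (@le_trans _ _ (rsum (fun t => w nu' t * gap t)%R +
      rsum (fun t => w nu' t * (2 * L t.1.2))%R)%E).
    rewrite -rsumD; last 2 first.
    - by move=> t; rewrite mulr_ge0 ?w0 ?gap0.
    - by move=> t; rewrite mulr_ge0 ?w0// mulr_ge0.
    apply: rsum_le => -[[a x] b].
    have [Bx|nBx] := pselect (B x); last first.
      by rewrite /w/= (Ps_eq0 nu'B nBx) mulr0 !mul0r addr0.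
    (* Here [rest - gap] is [D a - D (a * x) + L x], at most [2 * L x]. *)
    rewrite -mulrDr ler_wpM2l ?w0// /rest /gap/=.
    by have := D_step a Bx; rewrite ler_norml => /andP[]; lra.
  rewrite EFinD; apply: leeD.
    rewrite gapE EFinM.
    apply: le_trans (lee_wpmul2l _ (dev k.+1 m)); last by rewrite lee_fin exprn_ge0.
    rewrite -rsumZ ?exprn_ge0//; last by move=> t; rewrite !mulr_ge0.
    apply: rsum_le => t; rewrite !mulrA; do 2 rewrite ler_wpM2r//.
    by apply: le_cpow.
  by rewrite LE EFinM lee_wpmul2l.
have wrest_nu' : (0 <= rsum (fun t => w nu' t * rest t)%R)%E.
  by apply: rsum_ge0 => t; exact: wrest0.
set r' := rsum (fun t => w nu' t * rest t) in rest_le wrest_nu' *.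
have r'_fin : r' \is a fin_num.
  by rewrite ge0_fin_numE//; exact: le_lt_trans rest_le (ltry _).
rewrite -(leeD2rE _ _ r'_fin) split_sum//.
have L_le : (expect nu' L <= expect nu L + (eps * M)%:E)%E.
  apply: (@le_trans _ _ ((1 + eps)%R%:E * expect nu L)%E).
    rewrite -rsumZ//; last by move=> x; rewrite mulr_ge0.
    by apply: rsum_le => x; rewrite mulrA ler_wpM2r.
  rewrite EFinD ge0_muleDl ?mul1e// ?lee_fin//.
  by apply: leeD => //; rewrite EFinM lee_wpmul2l.
apply: (le_trans (leeD (lexx U) L_le)); rewrite addeA -(split_sum nu)//.
have r_le : (rsum (fun t => w nu t * rest t)%R <= r' + (eps * rho)%:E)%E.
  apply: (@le_trans _ _ ((1 + eps)%R%:E * r')%E).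
    rewrite -rsumZ//; last by move=> t; exact: wrest0.
    apply: rsum_le => t; have [Bx|nBx] := pselect (B t.1.2).
      rewrite mulrA ler_wpM2r ?rest0// /w.
      rewrite [leRHS](_ : _ = c' k t.1.1 * ((1 + eps) * nu' t.1.2) * c m t.2); last lra.
      by rewrite ler_wpM2r// ler_wpM2l.
    by rewrite /w (Ps_eq0 nuB nBx) (Ps_eq0 nu'B nBx) mulr0 !mul0r mulr0.
  rewrite EFinD ge0_muleDl ?mul1e// ?lee_fin//.
  by apply: leeD => //; rewrite EFinM lee_wpmul2l.
apply: (le_trans (leeD (leeD (lexx _) r_le) (lexx _))).
rewrite -!addeA; apply: leeD => //; rewrite [leRHS]addeC; apply: leeD => //.
by rewrite -EFinD lee_fin /rho; lra.
Qed.

(** Telescoping over hybrid walks whose first [k] increments have law [nu'] and whose other [n - k]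
    have law [nu]; the factor of the [k]-th replacement is bounded by its value at the last one. *)
Lemma replace_law n :
  (expect (c' n) D <=
   expect (c n) D + (n%:R * (eps * (1 + eps) ^+ n * (Dv + 3 * M)))%:E)%E.
Proof.
set err := eps * _ * _.
have e1 : 1 <= 1 + eps by rewrite lerDl.
have step k : (k <= n)%N -> (expect (convolution (c' k) (c (n - k)%N)) D <=
    expect (c n) D + (k%:R * err)%:E)%E.
  elim: k => [|k IH] kn; first by rewrite subn0 conv1p// mul0r adde0.
  have := replace_increment k (n - k.+1); rewrite -cpowS => /le_trans; apply.
  rewrite convA// -cpowSl// -subSn// subSS.
  apply: (le_trans (leeD (IH (ltnW kn)) (lexx _))).
  rewrite -addeA leeD2l// -EFinD lee_fin.
  have -> : k.+1%:R * err = k%:R * err + err by rewrite -natr1 mulrDl mul1r.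
  rewrite lerD2l /err -mulrA ler_wpM2l// mulrDr; apply: lerD.
    by rewrite ler_wpM2r// ler_weXn2l.
  by rewrite ler_peMl ?mulr_ge0// exprn_ege1.
by have := step n (leqnn n); rewrite subnn convp1.
Qed.

End Step.

(** * Density ratios and segments of measures *)

Section Neighborhood.
Variables (R : realType) (G : groupType) (B : set G).
Implicit Types p q : G -> R.

Definition ratio_le p q (a : R) := forall x, p x <= a * q x.

Lemma ndist_leP p q (d : R) : Ps B p -> Ps B q -> 0 <= d ->
  (ndist B p q <= d%:E)%E <-> ratio_le p q (1 + d) /\ ratio_le q p (1 + d).
Proof.
move=> pB qB d0; rewrite /ndist leeBlDr// -EFinD; split.
  move=> h.
  have {}h x : B x -> p x <= (1 + d) * q x /\ q x <= (1 + d) * p x.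
    move=> Bx; have px := Ps_gt0 pB Bx; have qx := Ps_gt0 qB Bx.
    have : ((Num.max (p x / q x) (q x / p x))%:E <= (d + 1)%:E)%E.
      by apply: le_trans h; apply: ereal_sup_ubound; exists x.
    rewrite lee_fin ge_max => /andP[]; rewrite !ler_pdivrMr// addrC => h1 h2.
    by split; rewrite // mulrC.
  split=> x; have [/h[]//|nBx] := pselect (B x);
    by rewrite (Ps_eq0 pB nBx) (Ps_eq0 qB nBx) mulr0.
move=> [h1 h2]; apply: ge_ereal_sup => _ [x Bx <-].
have px := Ps_gt0 pB Bx; have qx := Ps_gt0 qB Bx.
by rewrite lee_fin ge_max !ler_pdivrMr// (addrC d) h1 h2.
Qed.

Lemma ndist_ge0 p q : Ps B p -> Ps B q -> (0 <= ndist B p q)%E.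
Proof.
move=> pB qB; have [x Bx] := Ps_nonempty pB.
have px := Ps_gt0 pB Bx; have qx := Ps_gt0 qB Bx.
rewrite /ndist sube_ge0//; apply: (@le_trans _ _ (Num.max (p x / q x) (q x / p x))%:E); last first.
  by apply: ereal_sup_ubound; exists x.
rewrite lee_fin le_max; have [le_pq|/ltW le_qp] := leP (p x) (q x).
  by rewrite orbC ler_pdivlMr// mul1r le_pq.
by rewrite ler_pdivlMr// mul1r le_qp.
Qed.

Definition mix p q (t : R) (x : G) : R := (1 - t) * p x + t * q x.

Lemma mix_Ps p q t : Ps B p -> Ps B q -> 0 <= t <= 1 -> Ps B (mix p q t).
Proof.
move=> pB qB /andP[t0 t1].
have p0 x : 0 <= p x by apply: pmf_ge0; case: pB.
have q0 x : 0 <= q x by apply: pmf_ge0; case: qB.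
have s0 : 0 <= 1 - t by rewrite subr_ge0.
split.
- split=> [x|]; first by rewrite addr_ge0// mulr_ge0.
  rewrite -[LHS]/(rsum (mix p q t)) rsumD; do ?[by move=> x; rewrite mulr_ge0].
  by rewrite !rsumZ// !pmf_sum ?mule1 -?EFinD ?subrK; [|case: qB|case: pB].
- by move=> x; rewrite /mix (Ps_sym pB) (Ps_sym qB).
apply/seteqP; split => x /= => [|Bx].
  apply: contra_neqP => nBx.
  by rewrite /mix (Ps_eq0 pB nBx) (Ps_eq0 qB nBx) !mulr0 addr0.
have px := Ps_gt0 pB Bx; have qx := Ps_gt0 qB Bx.
rewrite gt_eqF// /mix; have [->|t_neq0] := eqVneq t 0.
  by rewrite subr0 mul1r mul0r addr0.
by rewrite ltr_wpDl ?mulr_ge0// mulr_gt0// lt0r t_neq0.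
Qed.

Lemma mix_ratio p q r t a : 0 <= t <= 1 -> ratio_le p r a -> ratio_le q r a ->
  ratio_le (mix p q t) r a.
Proof.
move=> /andP[t0 t1] pr qr x; rewrite /mix.
have s0 : 0 <= 1 - t by rewrite subr_ge0.
have := ler_wpM2l s0 (pr x); have := ler_wpM2l t0 (qr x); lra.
Qed.

Lemma ratio_mix p q r t a : 0 <= t <= 1 -> ratio_le r p a -> ratio_le r q a ->
  ratio_le r (mix p q t) a.
Proof.
move=> /andP[t0 t1] pr qr x; rewrite /mix.
have s0 : 0 <= 1 - t by rewrite subr_ge0.
have := ler_wpM2l s0 (pr x); have := ler_wpM2l t0 (qr x); lra.
Qed.

(* |q - p| <= d min(p, q), and every mixture is at least min(p, q). *)
Lemma mix_mix_ratio p q s t d : (forall x, 0 <= p x) -> (forall x, 0 <= q x) ->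
  0 <= s <= 1 -> 0 <= t <= 1 -> 0 <= d ->
  ratio_le p q (1 + d) -> ratio_le q p (1 + d) ->
  ratio_le (mix p q s) (mix p q t) (1 + `|s - t| * d).
Proof.
move=> p0 q0 /andP[s0 s1] /andP[t0 t1] d0 pq qp x.
have {}pq := pq x; have {}qp := qp x.
have st0 : 0 <= `|s - t| by [].
have key : mix p q s x - mix p q t x = (s - t) * (q x - p x) by rewrite /mix; lra.
rewrite mulrDl mul1r -lerBlDl key; apply: le_trans (ler_norm _) _.
rewrite normrM -mulrA ler_wpM2l//.
have t1' : 0 <= 1 - t by rewrite subr_ge0.
have dt : 0 <= d * t by rewrite mulr_ge0.
have dt' : 0 <= d * (1 - t) by rewrite mulr_ge0.
have [le_pq|lt_qp] := leP (p x) (q x).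
  rewrite ger0_norm ?subr_ge0//.
  have : 0 <= d * t * (q x - p x) by rewrite mulr_ge0// subr_ge0.
  by rewrite /mix; lra.
rewrite ltr0_norm ?subr_lt0//.
have : 0 <= d * (1 - t) * (p x - q x) by rewrite mulr_ge0// subr_ge0 ltW.
by rewrite /mix; lra.
Qed.

Definition ndist_ball (mu : G -> R) (K : R) : set (G -> R) :=
  [set nu | Ps B nu /\ (ndist B nu mu <= K%:E)%E].

End Neighborhood.

(** * Uniform estimates on a neighborhood *)

Section Main.
Variables (R : realType) (G : groupType) (B : set G).
Hypotheses (Bsym : symmetric_set B) (Bgen : generates B).
Hypothesis nonamenable : ~ amenable R G.
Variables (mu : G -> R) (K : R).
Hypotheses (muB : Ps B mu) (K0 : 0 < K) (mu_entropy : (entropy mu < +oo)%E).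

Local Notation N := (ndist_ball B mu K).

(** Every element is charged by some convolution power, and each mass function has countable
    support. *)
Lemma group_countable : countable [set: G].
Proof.
have pmu : is_pmf mu by case: muB.
have -> : [set: G] = \bigcup_(n in [set: nat]) [set x | convolution_power mu n x != 0].
  apply/seteqP; split => // x _.
  have [n nx] := cpow_reaches muB Bgen x.
  by exists n => //=; rewrite gt_eqF.
apply: bigcup_countable => // n _.
have pn := cpow_pmf pmu n.
by apply: pmf_support_countable; [case: pn|rewrite pmf_sum].
Qed.

Lemma nbhd_ratio nu : N nu -> ratio_le nu mu (1 + K) /\ ratio_le mu nu (1 + K).
Proof. by move=> [nuB]; move/(ndist_leP nuB muB (ltW K0)). Qed.

Lemma mix_nbhd p q t : N p -> N q -> 0 <= t <= 1 -> N (mix p q t).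
Proof.
move=> Np Nq t01; have [pB _] := Np; have [qB _] := Nq.
have mB := mix_Ps pB qB t01; split => //.
apply/(ndist_leP mB muB (ltW K0)).
have [p1 p2] := nbhd_ratio Np; have [q1 q2] := nbhd_ratio Nq.
by split; [exact: mix_ratio|exact: ratio_mix].
Qed.

Lemma nbhd_nbhd_ratio p q : N p -> N q -> ratio_le p q ((1 + K) ^+ 2).
Proof.
move=> Np Nq x; have [p1 _] := nbhd_ratio Np; have [_ q2] := nbhd_ratio Nq.
apply: le_trans (p1 x) _; rewrite expr2 -mulrA.
by apply: ler_wpM2l (q2 x); rewrite addr_ge0// ltW.
Qed.

(** Comparison with [mu] twice: the driving law costs a factor [1 + K], the logarithm an additive
    [ln (1 + K)]. This supplies the uniform bound on the one-step cost [- ln (nu' x)]. *)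
Lemma expect_log_nbhd : exists2 M : R, 0 <= M & forall nu nu', N nu -> N nu' ->
  (expect nu (fun x => - ln (nu' x))%R <= M%:E)%E.
Proof.
have pmu : is_pmf mu by case: muB.
have K1 : 0 < 1 + K by rewrite addr_gt0.
have lK : 0 <= ln (1 + K) by rewrite ln_ge0// lerDl ltW.
have HE : (fine (entropy mu))%:E = entropy mu.
  by rewrite fineK// ge0_fin_numE ?entropy_ge0.
exists ((1 + K) * (fine (entropy mu) + ln (1 + K))).
  by rewrite mulr_ge0 ?(ltW K1)// addr_ge0// fine_ge0// entropy_ge0.
move=> nu nu' Nnu Nnu'; have [nuB _] := Nnu; have [nu'B _] := Nnu'.
have [nu_le _] := nbhd_ratio Nnu; have [_ le_nu'] := nbhd_ratio Nnu'.
have mu0 x : 0 <= mu x by exact: pmf_ge0.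
have term0 x := entropy_term_ge0 x pmu.
rewrite EFinM (EFinD (fine _)) HE entropyE -(expect_cst pmu lK) -rsumD//; last first.
  by move=> x; rewrite mulr_ge0.
rewrite -rsumZ ?(ltW K1)//; last by move=> x; rewrite addr_ge0// mulr_ge0.
apply: rsum_le => x; have [Bx|nBx] := pselect (B x); last first.
  by rewrite (Ps_eq0 nuB nBx) (Ps_eq0 muB nBx) !(mulr0, mul0r, addr0).
have nu'x := Ps_gt0 nu'B Bx; have mux := Ps_gt0 muB Bx.
have h : - ln (nu' x) <= - ln (mu x) + ln (1 + K).
  have := le_nu' x; rewrite -ler_ln ?posrE ?mulr_gt0// lnM ?posrE//; lra.
have l0 : 0 <= - ln (nu' x).
  by rewrite oppr_ge0 ln_le0// pmf_le1//; case: nu'B.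
apply: (@le_trans _ _ (((1 + K) * mu x) * - ln (nu' x))).
  by rewrite ler_wpM2r.
rewrite -mulrA ler_wpM2l ?(ltW K1)//.
by have := ler_wpM2l (mu0 x) h; lra.
Qed.

Variable Dv : R.
Hypothesis Dv0 : 0 <= Dv.
Hypothesis deviation : forall nu nu', N nu -> N nu' -> forall n m,
  (rsum (fun t : G * G => convolution_power nu n t.1 * convolution_power nu m t.2 *
     (green_dist nu' t.1 + green_dist nu' t.2 - green_dist nu' (t.1 * t.2)%g))%R
   <= Dv%:E)%E.

(* The path from mu0 to mu1 is cut into n pieces, so that the n-step laws of
   consecutive pieces stay comparable uniformly in n. *)
Lemma expect_green_lipschitz : exists2 C : R, 0 < C &
  forall mu0 mu1 nu' (d : R), N mu0 -> N mu1 -> N nu' -> 0 <= d ->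
    (ndist B mu0 mu1 <= d%:E)%E -> d <= (1 + K) ^+ 2 -> forall n,
    (expect (convolution_power mu1 n) (green_dist nu') <=
     expect (convolution_power mu0 n) (green_dist nu') + (n%:R * (d * C))%:E)%E.
Proof.
have [M M0 logM] := expect_log_nbhd.
(* The exponential dominates [(1 + eps) ^+ n.+1] with [eps = d / n.+1], as [d] is at most
   [(1 + K) ^+ 2]. The final 1 makes [C] positive. *)
pose C := expR ((1 + K) ^+ 2) * (Dv + 3 * M) + 1.
have E0 : 0 <= Dv + 3 * M by rewrite addr_ge0// mulr_ge0.
have C0 : 0 < C by rewrite ltr_wpDl// mulr_ge0// expR_ge0.
exists C => // mu0 mu1 nu' d N0 N1 N' d0 dist dK [|n].
  by rewrite mul0r adde0.
have [mu0B _] := N0; have [mu1B _] := N1; have [nu'B _] := N'.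
have [r01 r10] := (ndist_leP mu0B mu1B d0).1 dist.
have n0 : 0 < n.+1%:R :> R by rewrite ltr0n.
pose z j := mix mu0 mu1 (j%:R / n.+1%:R).
pose eps := d / n.+1%:R.
have eps0 : 0 <= eps by rewrite divr_ge0// ltW.
have frac01 j : (j <= n.+1)%N -> 0 <= (j%:R / n.+1%:R : R) <= 1.
  by move=> jn; rewrite divr_ge0 ?(ltW n0)//= ler_pdivrMr// mul1r ler_nat.
have Nz j : (j <= n.+1)%N -> N (z j) by move=> jn; exact: mix_nbhd (frac01 _ jn).
have p0 x : 0 <= mu0 x by apply: pmf_ge0; case: mu0B.
have p1 x : 0 <= mu1 x by apply: pmf_ge0; case: mu1B.
have zz i j : (i <= n.+1)%N -> (j <= n.+1)%N -> `|i%:R - j%:R| = 1 :> R ->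
    ratio_le (z i) (z j) (1 + eps).
  move=> ilen jlen ij.
  have := mix_mix_ratio p0 p1 (frac01 _ ilen) (frac01 _ jlen) d0 r01 r10.
  rewrite -mulrBl normrM ij mul1r ger0_norm ?invr_ge0 ?(ltW n0)//.
  by rewrite [_^-1 * d]mulrC.
have step j : (j <= n.+1)%N ->
    (expect (convolution_power (z j) n.+1) (green_dist nu') <=
     expect (convolution_power mu0 n.+1) (green_dist nu') +
     (j%:R * (d * C))%:E)%E.
  elim: j => [|j IH] jn.
    have -> : z 0 = mu0.
      by apply/funext => x; rewrite /z /mix mul0r subr0 mul1r mul0r addr0.
    by rewrite mul0r adde0.
  have Nj := Nz _ (ltnW jn); have NSj := Nz _ jn.
  have [zB _] := Nj; have [zSB _] := NSj.
  have dSj : `|j.+1%:R - j%:R| = 1 :> R by rewrite -natr1 addrAC subrr add0r normr1.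
  apply: le_trans (replace_law (B := B) (nu := z j) (L := fun x => - ln (nu' x))
    (eps := eps) (Dv := Dv) (M := M) _ _ _ _ _ _ _ _ _ _ _ _ _ _ n.+1) _ => //.
  - exact: (green_dist_ge0 nu'B Bsym Bgen nonamenable).
  - by move=> x; rewrite oppr_ge0 ln_le0// pmf_le1//; case: nu'B.
  - exact: (green_dist_triangle nu'B Bsym Bgen nonamenable).
  - exact: (green_dist_step nu'B Bsym Bgen nonamenable).
  - by apply: zz => //; exact: ltnW.
  - by apply: zz => //; [exact: ltnW|rewrite distrC].
  - exact: logM.
  - exact: logM.
  - exact: deviation.
  apply: (le_trans (leeD (IH (ltnW jn)) (lexx _))).
  rewrite -addeA leeD2l// -EFinD lee_fin.
  have -> : j.+1%:R * (d * C) = j%:R * (d * C) + d * C by rewrite -natr1 mulrDl mul1r.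
  (* One piece of the segment replaces [n.+1] increments at a cost proportional to [eps], hence [d]
     up to a constant. *)
  have nE : n.+1%:R * eps = d by rewrite mulrC divfK// gt_eqF.
  rewrite lerD2l -(mulrA eps) (mulrA _ eps) nE ler_wpM2l// /C; apply: ler_wpDr => //; apply: ler_wpM2r => //.
  apply: (@le_trans _ _ (expR eps ^+ n.+1)).
    by rewrite lerXn2r ?nnegrE ?expR_ge1Dx ?addr_ge0// expR_ge0.
  rewrite -expRM_natl ler_expR; apply: le_trans dK.
  by rewrite nE.
have := step n.+1 (leqnn _).
suff -> : z n.+1 = mu1 by [].
by apply/funext => x; rewrite /z /mix divff ?gt_eqF// subrr mul0r mul1r add0r.
Qed.

End Main.

(** * Passage to the asymptotic entropy *)

(** The Gibbs comparison with [eta = 1] holds for every law, so the entropy of [nu] is controlled by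
    its mean Green distance for [mu]. That mean is at most [a] times the one under [mu], which the
    first moment makes finite. *)
Lemma entropy_nbhd_fin (R : realType) (G : groupType) (B : set G) (mu nu : G -> R)
    (a : R) :
  symmetric_set B -> generates B -> ~ amenable R G -> Ps B mu -> Ps B nu ->
  finite_first_moment mu -> 0 <= a -> ratio_le nu mu a -> (entropy nu < +oo)%E.
Proof.
move=> Bsym Bgen nonam muB nuB mom a0 nu_le.
have pmu : is_pmf mu by case: muB.
have pnu : is_pmf nu by case: nuB.
have D0 := green_dist_ge0 muB Bsym Bgen nonam.
have [C [C0 HC]] := entropy_le_green muB Bsym Bgen nonam (@ltr01 R).
apply: (le_lt_trans (HC nu pnu)); apply: lte_add_pinfty; last exact: ltry.
have fin_mu := moment_green_fin muB Bsym Bgen nonam mom pmu.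
apply: lte_mul_pinfty => //.
apply: (@le_lt_trans _ _ (a%:E * expect mu (green_dist mu))%E).
  rewrite -rsumZ//; last by move=> x; rewrite mulr_ge0// pmf_ge0.
  by apply: rsum_le => x; rewrite mulrA; apply: ler_wpM2r.
exact: lte_mul_pinfty.
Qed.

(** The additive [C] vanishes on division by the time. The rates are read at [n.+1], where the time
    is invertible. *)
Lemma le_asymptotic_entropy (R : realType) (G : groupType) (mu0 mu1 : G -> R)
    (e eta C : R) :
  is_pmf mu0 -> is_pmf mu1 ->
  (entropy mu0 < +oo)%E -> (entropy mu1 < +oo)%E -> 0 <= 1 + eta ->
  (forall n, (entropy (convolution_power mu1 n) <=
    (1 + eta)%R%:E * (entropy (convolution_power mu0 n) + (n%:R * e)%R%:E) + C%:E)%E) ->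
  asymptotic_entropy mu1 <= (1 + eta) * (asymptotic_entropy mu0 + e).
Proof.
move=> p0 p1 H0 H1 eta0 le_H.
have c0 : entropy_rate mu0 n.+1 @[n --> \oo] --> asymptotic_entropy mu0.
  by rewrite (cvg_shiftS (entropy_rate mu0)); exact: entropy_rate_cvg.
have c1 : entropy_rate mu1 n.+1 @[n --> \oo] --> asymptotic_entropy mu1.
  by rewrite (cvg_shiftS (entropy_rate mu1)); exact: entropy_rate_cvg.
have ch : (C * n.+1%:R^-1 : R) @[n --> \oo] --> C * 0.
  by apply: cvgMr; exact: cvg_harmonic.
have cd : ((1 + eta) * (entropy_rate mu0 n.+1 + e) + C * n.+1%:R^-1
    - entropy_rate mu1 n.+1) @[n --> \oo] -->
    (1 + eta) * (asymptotic_entropy mu0 + e) + C * 0 - asymptotic_entropy mu1.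
  apply: (cvgB _ c1); apply: (cvgD _ ch); apply: cvgMr; apply: (cvgD c0).
  exact: cvg_cst.
suff : 0 <= (1 + eta) * (asymptotic_entropy mu0 + e) + C * 0 - asymptotic_entropy mu1.
  by rewrite mulr0 addr0 subr_ge0.
apply: (closed_cvg (fun x : R => 0 <= x) _ _ _ cd); first exact: closed_ge.
apply: nearW => n; rewrite subr_ge0 /entropy_rate.
have := le_H n.+1; rewrite -(entropy_cpow_fineK p0 H0) -(entropy_cpow_fineK p1 H1).
rewrite -!EFinD lee_fin /=.
set h1 := fine _; set h0 := fine _; have n0 : 0 < n.+1%:R :> R by rewrite ltr0n.
move=> le_h; rewrite [leLHS]mulrC ler_pdivrMr//; apply: le_trans le_h _.
rewrite [leRHS]mulrDl divfK ?gt_eqF// lerD2r -mulrA ler_wpM2l//.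
by rewrite mulrDl [_^-1 * h0]mulrC divfK ?gt_eqF// (mulrC e).
Qed.

(** By left invariance and symmetry, the Gromov product seen from [Z_n] is half of
    [D x + D y - D (x * y)], where [x] is the position at time [n] and [y] the product of the next
    [m] increments; hence the factor 2. *)
Lemma deviation_sum (R : realType) (G : groupType) (B : set G)
    (nu nu' : G -> R) (disp : measure_display) (Omega : measurableType disp)
    (P : probability Omega R) (X : nat -> Omega -> G) (M : R) n m :
  symmetric_set B -> generates B -> ~ amenable R G -> Ps B nu -> Ps B nu' ->
  iid_of_law P X nu ->
  (\int[P]_(w in [set: Omega]) (gromov_product (green_metric nu') 1%g
     (walk X (n + m)%N w) (walk X n w))%:E <= M%:E)%E ->
  (rsum (fun t : G * G => convolution_power nu n t.1 * convolution_power nu m t.2 *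
     (green_dist nu' t.1 + green_dist nu' t.2 - green_dist nu' (t.1 * t.2)%g))%R
   <= (2 * M)%R%:E)%E.
Proof.
move=> Bsym Bgen nonam nuB nu'B Xiid leM.
have pnu : is_pmf nu by case: nuB.
pose Phi x y := gromov_product (green_metric nu') 1%g (x * y)%g x.
have PhiE x y : Phi x y =
    2^-1 * (green_dist nu' x + green_dist nu' y - green_dist nu' (x * y)%g).
  rewrite /Phi /gromov_product !(green_metricE nu') mulg1 mulKg invg1 mul1g.
  by rewrite (green_dist_sym nu'B)// mulrC.
have tri := green_dist_triangle nu'B Bsym Bgen nonam.
have Phi0 x y : 0 <= Phi x y by rewrite PhiE mulr_ge0 ?subr_ge0// invr_ge0.
have := le_expect_walk (group_countable Bgen nuB) pnu Xiid n m Phi0.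
have -> : rsum (fun t : G * G => convolution_power nu n t.1 * convolution_power nu m t.2 *
   (green_dist nu' t.1 + green_dist nu' t.2 - green_dist nu' (t.1 * t.2)%g)) =
  (2%:E * rsum (fun t : G * G => convolution_power nu n t.1 *
     convolution_power nu m t.2 * Phi t.1 t.2)%R)%E.
  rewrite -rsumZ//; last first.
    by move=> t; rewrite mulr_ge0 ?Phi0 ?mulr_ge0 ?(cpow_ge0 pnu).
  by apply: eq_rsum => t; rewrite PhiE; lra.
move=> /le_trans h; rewrite EFinM; apply: lee_wpmul2l; first by rewrite lee_fin.
apply: h; apply: le_trans leM.
have -> : (fun w => (Phi (walk X n w) (increment X n m w))%:E) =
    (fun w => (gromov_product (green_metric nu') 1%g
       (walk X (n + m)%N w) (walk X n w))%:E).
  by apply/funext => w; rewrite /Phi (walkD X n m w).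
exact: lexx.
Qed.

(** The two comparisons between entropy and Green distance are chained in the metric of [mu0]. After
    the limit in the time only the factor [1 + eta] is left, and [eta] is arbitrary. *)
Lemma asymptotic_entropy_le (R : realType) (G : groupType) (B : set G)
    (mu0 mu1 : G -> R) (e : R) :
  symmetric_set B -> generates B -> ~ amenable R G -> Ps B mu0 -> is_pmf mu1 ->
  (entropy mu0 < +oo)%E -> (entropy mu1 < +oo)%E ->
  (forall n, (expect (convolution_power mu1 n) (green_dist mu0) <=
    expect (convolution_power mu0 n) (green_dist mu0) + (n%:R * e)%R%:E)%E) ->
  asymptotic_entropy mu1 <= asymptotic_entropy mu0 + e.
Proof.
move=> Bsym Bgen nonam mu0B p1 H0 H1 le_D.
have p0 : is_pmf mu0 by case: mu0B.
set A := _ + e.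
have main eta : 0 < eta -> asymptotic_entropy mu1 <= (1 + eta) * A.
  move=> eta0; have eta1 : 0 <= 1 + eta by rewrite addr_ge0// ltW.
  have [C [C0 entG]] := entropy_le_green mu0B Bsym Bgen nonam eta0.
  apply: (le_asymptotic_entropy (C := C)) => // n.
  apply: (le_trans (entG _ (cpow_pmf p1 n))); rewrite leeD2r//.
  apply: lee_wpmul2l; first by rewrite lee_fin.
  apply: (le_trans (le_D n)).
  by rewrite leeD2r//; exact: expect_green_le_entropy mu0B Bsym Bgen nonam n.
apply/ler_addgt0Pr => eps eps0.
have nA0 : 0 < 1 + `|A| by rewrite ltr_pwDl.
(* Chosen so that [eta * A <= eps] whatever the sign of [A], including [A = 0]. *)
have eta0 : 0 < eps / (1 + `|A|) by rewrite divr_gt0.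
apply: (le_trans (main _ eta0)); rewrite mulrDl mul1r lerD2l.
rewrite mulrAC ler_pdivrMr// ler_pM2l//.
by apply: le_trans (ler_norm A) _; rewrite lerDr.
Qed.

Theorem theorem6p1 (R : realType) (G : groupType)
    (G_fg : finitely_generated G) (G_nonamenable : ~ amenable R G)
    (B : set G) (B_sym : symmetric_set B) (B_gen : generates B)
    (disp : measure_display) (Omega : measurableType disp)
    (X : nat -> Omega -> G) (P : (G -> R) -> probability Omega R)
    (X_iid : forall nu : G -> R, Ps B nu -> iid_of_law (P nu) X nu)
    (mu : G -> R) (mu_Ps : Ps B mu)
    (N0 : set (G -> R)) (N0_nbhd : neighborhood B mu N0)
    (deviation : (ereal_sup [set e : \bar R |
       exists mu' mu'' : G -> R, exists n m : nat,
         [/\ N0 mu', N0 mu''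
           & e = \int[P mu'']_(w in [set: Omega])
                   (gromov_product (green_metric mu') 1%g
                      (walk X (n + m)%N w) (walk X n w))%:E]] < +oo)%E)
    (mu_moment : finite_first_moment mu) :
  exists2 N : set (G -> R), neighborhood B mu N &
    (forall nu : G -> R, N nu -> asymptotic_entropy_defined nu) /\
    exists C : R, forall mu0 mu1 : G -> R, N mu0 -> N mu1 ->
      ((`|asymptotic_entropy mu1 - asymptotic_entropy mu0|)%:E
         <= C%:E * ndist B mu0 mu1)%E.
Proof.
exists N0 => //; move: N0_nbhd deviation => [K K0 ->].
rewrite -/(ndist_ball B mu K) => deviation.
have K1 : 0 <= 1 + K by rewrite addr_ge0// ltW.
have ent_fin nu : ndist_ball B mu K nu -> (entropy nu < +oo)%E.
  move=> Nnu; have [nuB _] := Nnu; have [le_nu _] := nbhd_ratio mu_Ps K0 Nnu.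
  exact: (entropy_nbhd_fin B_sym B_gen G_nonamenable mu_Ps nuB mu_moment K1 le_nu).
have pmfN nu : ndist_ball B mu K nu -> is_pmf nu by move=> [[]].
split=> [nu Nnu|].
  by split; [exact: ent_fin|apply: entropy_rate_cvg; [exact: pmfN|exact: ent_fin]].
have mu_fin : (entropy mu < +oo)%E.
  apply: ent_fin; split=> //; apply/(ndist_leP mu_Ps mu_Ps (ltW K0)).
  have p0 x : 0 <= mu x by apply: pmf_ge0; case: mu_Ps.
  by split=> x; rewrite ler_peMl// lerDl ltW.
have [M M0 MP] : exists2 M : R, 0 <= M & forall nu nu' n m,
    ndist_ball B mu K nu -> ndist_ball B mu K nu' ->
    (\int[P nu]_(w in [set: Omega]) (gromov_product (green_metric nu') 1%g
       (walk X (n + m)%N w) (walk X n w))%:E <= M%:E)%E.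
  move: deviation; set S := ereal_sup _ => Sfin; exists `|fine S| => //.
  move=> nu nu' n m Nnu Nnu'; apply: (@le_trans _ _ S).
    by apply: ereal_sup_ubound; exists nu', nu, n, m.
  by move: Sfin; case: (S) => [s| |]//= _; rewrite ?leNye// lee_fin ler_norm.
have M2 : 0 <= 2 * M by rewrite mulr_ge0.
have dev nu nu' : ndist_ball B mu K nu -> ndist_ball B mu K nu' -> forall n m,
    (rsum (fun t : G * G => convolution_power nu n t.1 * convolution_power nu m t.2 *
       (green_dist nu' t.1 + green_dist nu' t.2 - green_dist nu' (t.1 * t.2)%g))%R
     <= (2 * M)%R%:E)%E.
  move=> Nnu Nnu' n m; have [nuB _] := Nnu; have [nu'B _] := Nnu'.
  apply: (deviation_sum B_sym B_gen G_nonamenable nuB nu'B (X_iid nu nuB)).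
  exact: MP.
have [C C0 lip] :=
  expect_green_lipschitz B_sym B_gen G_nonamenable mu_Ps K0 mu_fin M2 dev.
have half mu0 mu1 d : ndist_ball B mu K mu0 -> ndist_ball B mu K mu1 ->
    0 <= d -> d <= (1 + K) ^+ 2 -> (ndist B mu0 mu1 <= d%:E)%E ->
    asymptotic_entropy mu1 <= asymptotic_entropy mu0 + d * C.
  move=> N0' N1' d0 dK dist; have [mu0B _] := N0'; have [mu1B _] := N1'.
  apply: (asymptotic_entropy_le B_sym B_gen G_nonamenable mu0B) => //.
  - exact: pmfN.
  - exact: ent_fin.
  - exact: ent_fin.
  - by move=> n; apply: lip.
exists C => mu0 mu1 N0' N1'; have [mu0B _] := N0'; have [mu1B _] := N1'.
have q0 : 0 <= (1 + K) ^+ 2 - 1 by rewrite subr_ge0 exprn_ege1// lerDl ltW.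
(* Passing through [mu] bounds the distance of any two points of [N0]. It is therefore a real number
   [d], within the range that [half] requires. *)
have : (ndist B mu0 mu1 <= ((1 + K) ^+ 2 - 1)%R%:E)%E.
  apply/(ndist_leP mu0B mu1B q0); rewrite addrC subrK.
  by split; apply: (nbhd_nbhd_ratio mu_Ps K0).
have := ndist_ge0 mu0B mu1B.
case dE : (ndist B mu0 mu1) => [d| |]//; rewrite !lee_fin => d0 dq.
have dK : d <= (1 + K) ^+ 2 by apply: le_trans dq _; rewrite gerBl.
have dist : (ndist B mu0 mu1 <= d%:E)%E by rewrite dE.
have dist' : (ndist B mu1 mu0 <= d%:E)%E.
  have [h1 h2] := (ndist_leP mu0B mu1B d0).1 dist.
  by apply/(ndist_leP mu1B mu0B d0).
have h1 := half _ _ d N0' N1' d0 dK dist.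
have h2 := half _ _ d N1' N0' d0 dK dist'.
by rewrite ler_norml; apply/andP; split; lra.
Qed.
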